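(* Let $K$ be a field and let $(\mathbf{FQSym})_+$ be the augmentation ideal of the Malvenuto–Reutenauer Hopf algebra over $K$, with basis $(\mathbf F_u)_{u\in S_n,\,n\ge1}$. For $u=(u_1\ldots u_n)\in S_n$ and $v=(v_1\ldots v_m)\in S_m$ ($n,m\ge1$) put $$\mathbf F_u\prec\mathbf F_v=\sum_{\substack{\zeta\in sh(n,m)\\ \zeta^{-1}(n+m)=n}}\mathbf F_{(u\times v).\zeta^{-1}},\qquad \mathbf F_u\succ\mathbf F_v=\sum_{\substack{\zeta\in sh(n,m)\\ \zeta^{-1}(n+m)=n+m}}\mathbf F_{(u\times v).\zeta^{-1}},$$ $$\Delta_\prec(\mathbf F_u)=\sum_{i=u^{-1}(n)}^{n-1}\mathbf F_{st(u_1\ldots u_i)}\otimes\mathbf F_{st(u_{i+1}\ldots u_n)},\qquad \Delta_\succ(\mathbf F_u)=\sum_{i=1}^{u^{-1}(n)-1}\mathbf F_{st(u_1\ldots u_i)}\otimes\mathbf F_{st(u_{i+1}\ldots u_n)}.$$ Then $((\mathbf{FQSym})_+,\prec,\succ,\Delta_\prec,\Delta_\succ)$ is a connected bidendriform bialgebra.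
   Context: Permutations $u\in S_n$ are written as words $(u_1\ldots u_n)$, $u_i=u(i)$. $sh(n,m)$ is the set of $(n,m)$-shuffles: $\zeta\in S_{n+m}$ with $\zeta(1)<\dots<\zeta(n)$ and $\zeta(n+1)<\dots<\zeta(n+m)$. $u\times v\in S_{n+m}$ is the permutation with word $u_1\ldots u_n(v_1+n)\ldots(v_m+n)$; thus the words of $(u\times v).\zeta^{-1}$, $\zeta \in sh(n,m)$, are the shuffles of $u_1\ldots u_n$ and $(v_1+n)\ldots(v_m+n)$, and the condition $\zeta^{-1}(n+m)=n$ (resp. $=n+m$) says that the last letter is $u_n$ (resp. $v_m+n$). $st$ denotes standardization of a word with distinct letters. A dendriform algebra is a $K$-vector space $A$ with linear maps $\prec,\succ:A\otimes A\to A$ such that for all $a,b,c$: $(a\prec b)\prec c=a\prec(b\prec c+b\succ c)$, $(a\succ b)\prec c=a\succ(b\prec c)$, $(a\prec b+a\succ b)\succ c=a\succ(b\succ c)$. One writes $ab=a\prec b+a\succ b$ (associative). A dendriform coalgebra is a $K$-vector space $C$ with $\Delta_\prec,\Delta_\succ:C\to C\otimes C$ such that, with $\tilde\Delta=\Delta_\prec+\Delta_\succ$: $(\Delta_\prec\otimes Id)\Delta_\prec=(Id\otimes\tilde\Delta)\Delta_\prec$, $(\Delta_\succ\otimes Id)\Delta_\prec=(Id\otimes\Delta_\prec)\Delta_\succ$, $(\tilde\Delta\otimes Id)\Delta_\succ=(Id\otimes\Delta_\succ)\Delta_\succ$. Notation (sums implicit): $\Delta_\prec(a)=a'_\prec\otimes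 a''_\prec$, $\Delta_\succ(a)=a'_\succ\otimes a''_\succ$, $\tilde\Delta(a)=a'\otimes a''$. A bidendriform bialgebra is $(A,\prec,\succ,\Delta_\prec,\Delta_\succ)$, both a dendriform algebra and a dendriform coalgebra, such that for all $a,b$: $\Delta_\succ(a\succ b)=a'b'_\succ\otimes a''\succ b''_\succ+a'\otimes a''\succ b+b'_\succ\otimes a\succ b''_\succ+ab'_\succ\otimes b''_\succ+a\otimes b$; $\Delta_\succ(a\prec b)=a'b'_\succ\otimes a''\prec b''_\succ+a'\otimes a''\prec b+b'_\succ\otimes a\prec b''_\succ$; $\Delta_\prec(a\succ b)=a'b'_\prec\otimes a''\succ b''_\prec+ab'_\prec\otimes b''_\prec+b'_\prec\otimes a\succ b''_\prec$; $\Delta_\prec(a\prec b)=a'b'_\prec\otimes a''\prec b''_\prec+a'b\otimes a''+b'_\prec\otimes a\prec b''_\prec+b\otimes a$. Connectedness: for a dendriform coalgebra $C$ put $\mathcal P_C(0)=\{Id_C\}$ and, for $n\ge1$, let $\mathcal P_C(n)$ be the set of maps $(Id^{\otimes(i-1)}\otimes\delta\otimes Id^{\otimes(n-i)})\circ P:C\to C^{\otimes(n+1)}$ with $P\in\mathcal P_C(n-1)$, $1\le i\le n$, $\delta\in\{\Delta_\prec,\Delta_\succ\}$. $C$ is connected if for every $a\in C$ there is $n_a\in\mathbb N$ with $P(a)=0$ for all $P\in\mathcal P_C(n_a)$; a bidendriform bialgebra is connected if it is so as a dendriform coalgebra. *)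

(* Defs.v *)
From HB Require Import structures.
From mathcomp Require Import all_boot all_fingroup all_algebra.
From mathcomp Require Import boolp finmap monalg.

Set Implicit Arguments.
Unset Strict Implicit.
Unset Printing Implicit Defensive.

Import GRing.Theory.
Local Open Scope ring_scope.

Section LinearExtension.
Variables (K : fieldType) (T : choiceType) (U : lmodType K).

(* the linear map on the free vector space on T that extends f *)
Definition lin_ext (f : T -> U) (x : {malg K[T]}) : U :=
  \sum_(t <- msupp x) x@_t *: f t.

Lemma lin_extE (f : T -> U) (d : {fset T}) (x : {malg K[T]}) :
  (msupp x `<=` d)%fset -> lin_ext f x = \sum_(t <- d) x@_t *: f t.
Proof.
move=> le_d; rewrite /lin_ext (big_fset_incl _ le_d) //= => t _ tNx.
by rewrite mcoeff_outdom // scale0r.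
Qed.

Lemma lin_ext_linear (f : T -> U) : linear (lin_ext f).
Proof.
move=> c x y; pose d := (msupp x `|` msupp y)%fset.
have lex : (msupp x `<=` d)%fset by apply: fsubsetUl.
have ley : (msupp y `<=` d)%fset by apply: fsubsetUr.
have lez : (msupp (c *: x + y) `<=` d)%fset.
  apply: fsubset_trans (msuppD_le _ _) _; apply: fsetSU; exact: msuppZ_le.
rewrite (lin_extE _ lex) (lin_extE _ ley) (lin_extE _ lez).
rewrite scaler_sumr -big_split /=; apply: eq_bigr => t _.
by rewrite mcoeffD mcoeffZ scalerDl scalerA.
Qed.

HB.instance Definition _ (f : T -> U) :=
  GRing.isLinear.Build K {malg K[T]} U *:%R (lin_ext f) (lin_ext_linear f).

Lemma lin_extU (f : T -> U) t : lin_ext f << t >> = f t.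
Proof.
rewrite (lin_extE _ (@msuppU_le _ _ t 1)) big_seq_fset1 mcoeffUU.
exact: scale1r.
Qed.

End LinearExtension.

(* V (x) W is the free vector space on V * W modulo the bilinear relations *)
Section TensorProduct.
Variables (K : fieldType) (V W : lmodType K).

Definition pairs_space := {malg K[(V * W)%type]}.

Definition free_pair (x : V) (y : W) : pairs_space := << (x, y) >>.

Inductive tensor_rel : pairs_space -> Prop :=
| TRel0 : tensor_rel 0
| TRelP c p q : tensor_rel p -> tensor_rel q -> tensor_rel (c *: p + q)
| TRelL c x x' y :
    tensor_rel (free_pair (c *: x + x') y
                - (c *: free_pair x y + free_pair x' y))
| TRelR c x y y' :
    tensor_rel (free_pair x (c *: y + y')
                - (c *: free_pair x y + free_pair x y')).

Definition tensor_rels : {pred pairs_space} := fun p => `[< tensor_rel p >].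

Lemma tensor_rels_zmod : zmod_closed tensor_rels.
Proof.
split=> [|p q /asboolP rp /asboolP rq]; first by apply/asboolP; constructor.
by apply/asboolP; rewrite addrC -scaleN1r; constructor.
Qed.

HB.instance Definition _ :=
  GRing.isZmodClosed.Build pairs_space tensor_rels tensor_rels_zmod.

Definition tensor : Type := Quotient.quot tensor_rels.

HB.instance Definition _ := GRing.Zmodule.on tensor.

Definition tpi (p : pairs_space) : tensor :=
  (\pi_(Quotient.quot tensor_rels) p)%qT.
Definition trepr (t : tensor) : pairs_space := generic_quotient.repr t.

Lemma treprK : cancel trepr tpi.
Proof. exact: generic_quotient.reprK. Qed.

Lemma tpi_eq p q : tpi p = tpi q <-> tensor_rel (p - q).
Proof.
split=> [/eqP e|r].
  by apply/asboolP; move: e; rewrite /tpi -Quotient.idealrBE.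
by apply/eqP; rewrite /tpi -Quotient.idealrBE; apply/asboolP.
Qed.

Lemma tpiD p q : tpi (p + q) = tpi p + tpi q.
Proof. by rewrite /tpi raddfD. Qed.

Lemma tensor_relZ c p : tensor_rel p -> tensor_rel (c *: p).
Proof. by move=> rp; rewrite -[_ *: _]addr0; apply: TRelP rp TRel0. Qed.

Definition tscale (c : K) (t : tensor) : tensor := tpi (c *: trepr t).

Lemma tscaleE c p : tscale c (tpi p) = tpi (c *: p).
Proof.
apply/tpi_eq; rewrite -scalerBr; apply: tensor_relZ.
by apply/tpi_eq; rewrite treprK.
Qed.

Lemma tscaleA c d t : tscale c (tscale d t) = tscale (c * d) t.
Proof. by rewrite -[t]treprK !tscaleE scalerA. Qed.

Lemma tscale1 : left_id 1 tscale.
Proof. by move=> t; rewrite -[t]treprK tscaleE scale1r. Qed.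

Lemma tscaleDr : right_distributive tscale +%R.
Proof.
by move=> c t u; rewrite -[t]treprK -[u]treprK -tpiD !tscaleE scalerDr tpiD.
Qed.

Lemma tscaleDl t : {morph tscale^~ t : c d / c + d}.
Proof. by move=> c d; rewrite -[t]treprK !tscaleE scalerDl tpiD. Qed.

HB.instance Definition _ :=
  GRing.Zmodule_isLmodule.Build K tensor tscaleA tscale1 tscaleDr tscaleDl.

Lemma tpiZ c p : tpi (c *: p) = c *: tpi p.
Proof. by rewrite -tscaleE. Qed.

Definition tens (x : V) (y : W) : tensor := tpi (free_pair x y).

End TensorProduct.

Notation "x ⊗ y" := (tens x y) (at level 40, left associativity) : ring_scope.

Section UniversalProperty.
Variables (K : fieldType) (V W U : lmodType K).

Lemma tens_linearl (y : W) : linear (fun x : V => x ⊗ y).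
Proof.
move=> c x x'; rewrite /tens -tpiZ -tpiD; apply/tpi_eq; exact: TRelL.
Qed.

Lemma tens_linearr (x : V) : linear (fun y : W => x ⊗ y).
Proof.
move=> c y y'; rewrite /tens -tpiZ -tpiD; apply/tpi_eq; exact: TRelR.
Qed.

(* Sweedler sum: for bilinear f and t the sum of the x_i ⊗ y_i, sw t f is the
   sum of the f x_i y_i (sw_tens and sw_linear below).  The value on a
   representative of t is independent of it only when f is bilinear. *)
Definition sw (t : tensor V W) (f : V -> W -> U) : U :=
  lin_ext (fun p => f p.1 p.2) (trepr t).

Definition bilin (f : V -> W -> U) : Prop :=
  (forall y, linear (f^~ y)) /\ (forall x, linear (f x)).

Variables (f : V -> W -> U) (bf : bilin f).

Lemma sw_tpi p : sw (tpi p) f = lin_ext (fun q => f q.1 q.2) p.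
Proof.
have [fl fr] := bf; have k r : tensor_rel r ->
    lin_ext (fun q => f q.1 q.2) r = 0.
  elim=> [|c q q' _ e _ e'|c x x' y|c x y y'] //=.
  - exact: linear0.
  - by rewrite linearP /= e e' scaler0 addr0.
  - by rewrite linearB linearP /= !lin_extU /= fl subrr.
  - by rewrite linearB linearP /= !lin_extU /= fr subrr.
apply/eqP; rewrite -subr_eq0 /sw -linearB /=; apply/eqP/k/tpi_eq.
exact: treprK.
Qed.

Lemma sw_tens x y : sw (x ⊗ y) f = f x y.
Proof. by rewrite sw_tpi lin_extU. Qed.

Lemma sw_linear : linear (fun t => sw t f).
Proof.
move=> c t u; rewrite -[t]treprK -[u]treprK -tpiZ -tpiD !sw_tpi.
exact: linearP.
Qed.

End UniversalProperty.

Section TensorMaps.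
Variable K : fieldType.

Definition tmap (V V' W W' : lmodType K) (f : V -> V') (g : W -> W')
  (t : tensor V W) : tensor V' W' := sw t (fun x y => f x ⊗ g y).

Definition tassoc (U V W : lmodType K) (t : tensor (tensor U V) W) :
    tensor U (tensor V W) :=
  sw t (fun s z => sw s (fun x y => x ⊗ (y ⊗ z))).

(* tpow C n is the tensor power of C with n.+1 factors, bracketed to the
   right *)
Fixpoint tpow (C : lmodType K) (n : nat) : lmodType K :=
  if n is n'.+1 then tensor C (tpow C n') else C.

(* delta applied to the factor of index i, counted from 0, of the n.+1
   factors of tpow C n *)
Fixpoint tpow_at (C : lmodType K) (delta : C -> tensor C C) (n i : nat) :
    tpow C n -> tpow C n.+1 :=
  match n, i return tpow C n -> tpow C n.+1 with
  | 0, _ => delta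
  | n'.+1, 0 => fun t => tassoc (tmap delta id t)
  | n'.+1, i'.+1 => tmap id (@tpow_at C delta n' i')
  end.

End TensorMaps.

Section DendriformAlgebra.
Variables (K : fieldType) (A : lmodType K).
Variables prec succ : tensor A A -> A.

Local Notation "a ≺ b" := (prec (a ⊗ b)) (at level 40).
Local Notation "a ≻ b" := (succ (a ⊗ b)) (at level 40).

Definition dmul (a b : A) : A := a ≺ b + a ≻ b.

Record dendriform_algebra : Prop := {
  prec_linear : linear prec;
  succ_linear : linear succ;
  prec_precA : forall a b c : A, (a ≺ b) ≺ c = a ≺ (b ≺ c + b ≻ c);
  succ_precA : forall a b c : A, (a ≻ b) ≺ c = a ≻ (b ≺ c);
  succ_succA : forall a b c : A, (a ≺ b + a ≻ b) ≻ c = a ≻ (b ≻ c)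
}.

End DendriformAlgebra.

Section DendriformCoalgebra.
Variables (K : fieldType) (C : lmodType K).
Variables Dprec Dsucc : C -> tensor C C.

Definition Dtilde (a : C) : tensor C C := Dprec a + Dsucc a.

Record dendriform_coalgebra : Prop := {
  Dprec_linear : linear Dprec;
  Dsucc_linear : linear Dsucc;
  Dprec_DprecA : forall a : C,
    tassoc (tmap Dprec id (Dprec a)) = tmap id Dtilde (Dprec a);
  Dsucc_DprecA : forall a : C,
    tassoc (tmap Dsucc id (Dprec a)) = tmap id Dprec (Dsucc a);
  Dtilde_DsuccA : forall a : C,
    tassoc (tmap Dtilde id (Dsucc a)) = tmap id Dsucc (Dsucc a)
}.

Inductive iter_coproduct : forall n : nat, (C -> tpow C n) -> Prop :=
| IterId : iter_coproduct (n := 0) (fun a => a)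
| IterPrec n (i : 'I_n.+1) (P : C -> tpow C n) :
    iter_coproduct P ->
    iter_coproduct (n := n.+1) (fun a => tpow_at Dprec i (P a))
| IterSucc n (i : 'I_n.+1) (P : C -> tpow C n) :
    iter_coproduct P ->
    iter_coproduct (n := n.+1) (fun a => tpow_at Dsucc i (P a)).

Definition connected_coalgebra : Prop :=
  forall a : C, exists n : nat,
    forall P : C -> tpow C n, iter_coproduct P -> P a = 0.

End DendriformCoalgebra.

Section Bidendriform.
Variables (K : fieldType) (A : lmodType K).
Variables (prec succ : tensor A A -> A) (Dprec Dsucc : A -> tensor A A).

Local Notation "a ≺ b" := (prec (a ⊗ b)) (at level 40).
Local Notation "a ≻ b" := (succ (a ⊗ b)) (at level 40).
Local Notation "a · b" := (dmul prec succ a b) (at level 40).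
Local Notation Dt := (Dtilde Dprec Dsucc).

Record bidendriform_bialgebra : Prop := {
  bidend_algebra : dendriform_algebra prec succ;
  bidend_coalgebra : dendriform_coalgebra Dprec Dsucc;
  Dsucc_succ : forall a b : A,
    Dsucc (a ≻ b) =
      sw (Dt a) (fun a1 a2 =>
        sw (Dsucc b) (fun b1 b2 => (a1 · b1) ⊗ (a2 ≻ b2)))
      + sw (Dt a) (fun a1 a2 => a1 ⊗ (a2 ≻ b))
      + sw (Dsucc b) (fun b1 b2 => b1 ⊗ (a ≻ b2))
      + sw (Dsucc b) (fun b1 b2 => (a · b1) ⊗ b2)
      + a ⊗ b;
  Dsucc_prec : forall a b : A,
    Dsucc (a ≺ b) =
      sw (Dt a) (fun a1 a2 =>
        sw (Dsucc b) (fun b1 b2 => (a1 · b1) ⊗ (a2 ≺ b2)))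
      + sw (Dt a) (fun a1 a2 => a1 ⊗ (a2 ≺ b))
      + sw (Dsucc b) (fun b1 b2 => b1 ⊗ (a ≺ b2));
  Dprec_succ : forall a b : A,
    Dprec (a ≻ b) =
      sw (Dt a) (fun a1 a2 =>
        sw (Dprec b) (fun b1 b2 => (a1 · b1) ⊗ (a2 ≻ b2)))
      + sw (Dprec b) (fun b1 b2 => (a · b1) ⊗ b2)
      + sw (Dprec b) (fun b1 b2 => b1 ⊗ (a ≻ b2));
  Dprec_prec : forall a b : A,
    Dprec (a ≺ b) =
      sw (Dt a) (fun a1 a2 =>
        sw (Dprec b) (fun b1 b2 => (a1 · b1) ⊗ (a2 ≺ b2)))
      + sw (Dt a) (fun a1 a2 => (a1 · b) ⊗ a2)
      + sw (Dprec b) (fun b1 b2 => b1 ⊗ (a ≺ b2))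
      + b ⊗ a
}.

Definition connected_bidendriform_bialgebra : Prop :=
  bidendriform_bialgebra /\ connected_coalgebra Dprec Dsucc.

End Bidendriform.

Section Shuffles.
Variables n m : nat.

(* 'I_(n + m) is the disjoint union of the images of lshift m : 'I_n -> _
   (the first n positions) and rshift n : 'I_m -> _ (the last m positions) *)
Definition sh : {set 'S_(n + m)} :=
  [set z : 'S_(n + m) |
    [forall i : 'I_n, forall j : 'I_n,
       (i < j)%N ==> (z (lshift m i) < z (lshift m j))%N] &&
    [forall i : 'I_m, forall j : 'I_m,
       (i < j)%N ==> (z (rshift n i) < z (rshift n j))%N]].

Definition cross_fun (u : 'S_n) (v : 'S_m) (i : 'I_(n + m)) : 'I_(n + m) :=
  match split i with
  | inl j => lshift m (u j)
  | inr j => rshift n (v j)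
  end.

Lemma cross_fun_inj u v : injective (cross_fun u v).
Proof.
move=> i j; rewrite /cross_fun; case: splitP => i' ei; case: splitP => j' ej.
- move/lshift_inj/perm_inj => e; apply: val_inj.
  by rewrite /= ei ej e.
- by move/eqP; rewrite eq_lrshift.
- by move/eqP; rewrite eq_rlshift.
- move/rshift_inj/perm_inj => e; apply: val_inj.
  by rewrite /= ei ej e.
Qed.

Definition cross (u : 'S_n) (v : 'S_m) : 'S_(n + m) :=
  perm (@cross_fun_inj u v).

End Shuffles.

(* words carry the letters 1, ..., n *)
Definition word n (u : 'S_n) : seq nat := [seq (val (u i)).+1 | i <- enum 'I_n].

Section Standardization.
Variable w : seq nat.

Definition rank (i : 'I_(size w)) : nat :=
  count (fun x => x < nth 0 w i)%N w.

Lemma rank_subproof i : (rank i < size w)%N.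
Proof.
rewrite /rank -[X in (_ < X)%N](count_predC (fun x => x < nth 0 w i)%N w) -addn1 leq_add2l.
rewrite -has_count; apply/hasP; exists (nth 0 w i); last by rewrite /= ltnn.
exact: mem_nth.
Qed.

Definition rank_ffun : {ffun 'I_(size w) -> 'I_(size w)} :=
  [ffun i => Ordinal (rank_subproof i)].

(* meaningful only for words with distinct letters, see stE *)
Definition st : 'S_(size w) := insubd (1%g : 'S_(size w)) rank_ffun.

Lemma stE : uniq w -> forall i, val (st i) = rank i.
Proof.
move=> Uw i; suff inj : injectiveb rank_ffun.
  by rewrite /st -pvalE /insubd insubT /= ffunE.
have mono (a b : 'I_(size w)) :
    (nth 0 w a < nth 0 w b)%N -> (rank a < rank b)%N.
  move=> lt_ab; pose s := [seq x <- w | x < nth 0 w b]%N.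
  rewrite /rank -[X in (_ < X)%N]size_filter -/s.
  rewrite -(count_predC (fun x => x < nth 0 w a)%N s) /s count_filter.
  rewrite (@eq_count _ (predI _ _) (fun x => x < nth 0 w a)%N); last first.
    by move=> x /=; apply/andb_idr => lt_xa; exact: ltn_trans lt_xa lt_ab.
  rewrite -addn1 leq_add2l -has_count; apply/hasP; exists (nth 0 w a).
    by rewrite mem_filter lt_ab mem_nth.
  by rewrite /= ltnn.
apply/injectiveP => a b; rewrite !ffunE => /(congr1 val) /= e.
apply/val_inj/eqP; rewrite /= -(nth_uniq 0 (ltn_ord a) (ltn_ord b) Uw).
by case: ltngtP => // /mono; rewrite e ltnn.
Qed.

End Standardization.

Section FQSym.
Variable K : fieldType.

(* Tagged _ u with u : 'S_n.+1 ranges over the permutations of positive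
   size *)
Definition FQSym_index := {n : nat & 'S_n.+1}.

Definition FQSym_plus := {malg K[FQSym_index]}.
HB.instance Definition _ := GRing.Lmodule.on FQSym_plus.

(* the basis vector F_u; the value 0 at n = 0 is never used below *)
Definition F n : 'S_n -> FQSym_plus :=
  if n is n'.+1 return 'S_n -> FQSym_plus
  then fun u => << Tagged (fun k => 'S_k.+1) u >> else fun _ => 0.

(* Indices are counted from 0, so rshift n.+1 ord_max is the last of the
   n.+1 + m.+1 positions and lshift m.+1 ord_max is the last position of u.
   The product s * t maps x to t (s x), so z^-1 * cross u v is the composite
   (cross u v) o z^-1. *)
Definition F_prec n m (u : 'S_n.+1) (v : 'S_m.+1) : FQSym_plus :=
  \sum_(z in sh n.+1 m.+1
        | (z^-1)%g (rshift n.+1 ord_max) == lshift m.+1 ord_max)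
    F (z^-1 * cross u v)%g.

Definition F_succ n m (u : 'S_n.+1) (v : 'S_m.+1) : FQSym_plus :=
  \sum_(z in sh n.+1 m.+1
        | (z^-1)%g (rshift n.+1 ord_max) == rshift n.+1 ord_max)
    F (z^-1 * cross u v)%g.

(* F_{st (u_1 ... u_i)} ⊗ F_{st (u_{i+1} ... u_n)} *)
Definition F_cut n (u : 'S_n) (i : nat) : tensor FQSym_plus FQSym_plus :=
  F (st (take i (word u))) ⊗ F (st (drop i (word u))).

(* the position of the largest letter, counted from 1 *)
Definition max_pos n (u : 'S_n.+1) : nat := ((u^-1)%g ord_max).+1.

Definition F_Dprec n (u : 'S_n.+1) : tensor FQSym_plus FQSym_plus :=
  \sum_(max_pos u <= i < n.+1) F_cut u i.

Definition F_Dsucc n (u : 'S_n.+1) : tensor FQSym_plus FQSym_plus :=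
  \sum_(1 <= i < max_pos u) F_cut u i.

Definition bilin_ext (f : FQSym_index -> FQSym_index -> FQSym_plus)
    (t : tensor FQSym_plus FQSym_plus) : FQSym_plus :=
  sw t (fun x y => lin_ext (fun p => lin_ext (f p) y) x).

Definition fq_prec : tensor FQSym_plus FQSym_plus -> FQSym_plus :=
  bilin_ext (fun p q => F_prec (tagged p) (tagged q)).

Definition fq_succ : tensor FQSym_plus FQSym_plus -> FQSym_plus :=
  bilin_ext (fun p q => F_succ (tagged p) (tagged q)).

Definition fq_Dprec : FQSym_plus -> tensor FQSym_plus FQSym_plus :=
  lin_ext (fun p => F_Dprec (tagged p)).

Definition fq_Dsucc : FQSym_plus -> tensor FQSym_plus FQSym_plus :=
  lin_ext (fun p => F_Dsucc (tagged p)).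

Lemma bilin_extP (f : FQSym_index -> FQSym_index -> FQSym_plus) :
  bilin (fun x y => lin_ext (fun p => lin_ext (f p) y) x).
Proof.
split=> [y|x c y y']; first exact: lin_ext_linear.
have e z : lin_ext (fun p => lin_ext (f p) z) x =
    \sum_(p <- msupp x) x@_p *: lin_ext (f p) z by [].
rewrite !e scaler_sumr -big_split /=; apply: eq_bigr => p _.
by rewrite linearP /= scalerDr !scalerA mulrC.
Qed.

Lemma fq_precE n m (u : 'S_n.+1) (v : 'S_m.+1) :
  fq_prec (F u ⊗ F v) = F_prec u v.
Proof. by rewrite /fq_prec /bilin_ext (sw_tens (bilin_extP _)) !lin_extU. Qed.

Lemma fq_succE n m (u : 'S_n.+1) (v : 'S_m.+1) :
  fq_succ (F u ⊗ F v) = F_succ u v.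
Proof. by rewrite /fq_succ /bilin_ext (sw_tens (bilin_extP _)) !lin_extU. Qed.

Lemma fq_DprecE n (u : 'S_n.+1) : fq_Dprec (F u) = F_Dprec u.
Proof. by rewrite /fq_Dprec lin_extU. Qed.

Lemma fq_DsuccE n (u : 'S_n.+1) : fq_Dsucc (F u) = F_Dsucc u.
Proof. by rewrite /fq_Dsucc lin_extU. Qed.

End FQSym.

(* Main.v *)
Require Import Defs.
From mathcomp Require Import all_boot all_fingroup all_algebra.
From mathcomp Require Import finmap monalg.

Set Implicit Arguments.
Unset Strict Implicit.
Unset Printing Implicit Defensive.

Import GRing.Theory.
Local Open Scope ring_scope.

(** Every basis element is represented by words with distinct letters, up to
    increasing relabelling. Products of basis elements are then sums over
    shuffles of two words on successive alphabets, split according to the word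
    that provides the last letter, and coproducts are sums over the cuts of a
    word, split according to the piece that contains the largest letter
    ([fq_prec_Frev], [fq_succ_Frev], [fq_Dprec_Frev], [fq_Dsucc_Frev]). The
    passage from the permutations in [sh] to shuffles of words is
    [sh_shuffles]. Words are reversed throughout, so that the last letter is
    the head of a list.

    By linearity ([lin_eq], [bilin_eq], [trilin_eq]) every axiom has to be
    checked only on words with increasing alphabets, where it becomes an
    identity between sums over shuffles and cuts.

    For the dendriform axioms, the shuffles of three words are sorted by the
    word that provides the last letter; once this letter is removed, the
    associativity of shuffles [shufflesA] remains. For the coalgebra axioms,
    both sides run over the cuts of a word into three pieces ([cutsA]), and the
    conditions on largest letters single out the same piece ([cut_coassoc]).

    The four mixed identities come from one fact: cutting a shuffle amounts to
    cutting both words and shuffling the pieces ([cuts_shuffles]). The last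
    letter of the shuffle is the last letter of its right piece, so the
    half-product occurs in the right tensor factor only; the largest letter
    belongs to the second word, so the half-coproduct is that of the second
    factor. The various terms of the identities correspond to the trivial and
    nontrivial cuts of the two words ([coproduct_half_product_inner]).

    Finally, coproducts preserve the total length of words, and the empty word
    represents 0; so a tensor with more factors than its degree vanishes, which
    gives connectedness ([iter_coproduct_pure], [pure_tensor_eq0]). *)

(** * Linear and bilinear maps on tensor products *)

Section LinearMaps.
Variable K : fieldType.
Implicit Types U V W X : lmodType K.

Lemma lin_sum V U (f : V -> U) : linear f ->
  forall (I : Type) (r : seq I) (P : pred I) (E : I -> V),
  f (\sum_(i <- r | P i) E i) = \sum_(i <- r | P i) f (E i).
Proof.
move=> lf I r P E; apply: (big_morph f).
  by move=> x y; rewrite -[x in LHS]scale1r lf scale1r.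
by have := lf (-1) 0 0; rewrite !scaleN1r oppr0 addr0 addNr.
Qed.

Lemma lin0 V U (f : V -> U) : linear f -> f 0 = 0.
Proof.
by move=> lf; have := lf (-1) 0 0; rewrite !scaleN1r oppr0 addr0 addNr.
Qed.

Lemma linD V U (f : V -> U) : linear f -> {morph f : x y / x + y}.
Proof. by move=> lf x y; rewrite -[x in LHS]scale1r lf scale1r. Qed.

Lemma lin_add V U (f g : V -> U) :
  linear f -> linear g -> linear (fun x => f x + g x).
Proof. by move=> lf lg c x y; rewrite lf lg scalerDr addrACA. Qed.

Lemma lin_comp V W U (f : W -> U) (g : V -> W) :
  linear f -> linear g -> linear (fun x => f (g x)).
Proof. by move=> lf lg c x y; rewrite lg lf. Qed.

Lemma lin_id V : linear (fun x : V => x).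
Proof. by []. Qed.

Lemma tens0l V W (y : W) : (0 : V) ⊗ y = 0.
Proof. exact: lin0 (@tens_linearl K V W y). Qed.

Lemma tens0r V W (x : V) : x ⊗ (0 : W) = 0.
Proof. exact: lin0 (@tens_linearr K V W x). Qed.

Lemma bilin_tens V V' W W' (f : V -> V') (g : W -> W') :
  linear f -> linear g -> bilin (fun x y => f x ⊗ g y).
Proof.
move=> lf lg; split=> [y|x].
  exact: (@lin_comp _ _ _ (fun x => x ⊗ g y) f (@tens_linearl K _ _ (g y)) lf).
exact: (@lin_comp _ _ _ (fun y => f x ⊗ y) g (@tens_linearr K _ _ (f x)) lg).
Qed.

(** The representative of [t] being fixed, the Sweedler sum is a fixed finite
    combination of values of [f z]. Together with [lin_sw] this handles the two
    ways in which the terms of the bidendriform identities depend on their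
    arguments. *)
Lemma lin_sw_fun V W U X (t : tensor V W) (f : X -> V -> W -> U) :
  (forall x y, linear (fun z => f z x y)) -> linear (fun z => sw t (f z)).
Proof.
move=> lf c z z'; rewrite /sw /lin_ext scaler_sumr -big_split /=.
by apply: eq_bigr => p _; rewrite lf scalerDr !scalerA mulrC.
Qed.

Lemma lin_sw V W U X (D : X -> tensor V W) (f : V -> W -> U) :
  linear D -> bilin f -> linear (fun z => sw (D z) f).
Proof.
move=> lD bf; apply: (lin_comp (f := fun t => sw t f)) lD => c s t.
exact: (sw_linear bf).
Qed.

Lemma tmap_tens V V' W W' (f : V -> V') (g : W -> W') x y :
  linear f -> linear g -> tmap f g (x ⊗ y) = f x ⊗ g y.
Proof. by move=> lf lg; rewrite /tmap (sw_tens (bilin_tens lf lg)). Qed.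

Lemma tmap_linear V V' W W' (f : V -> V') (g : W -> W') :
  linear f -> linear g -> linear (tmap f g).
Proof.
by move=> lf lg; apply: lin_sw (bilin_tens lf lg) => //; apply: lin_id.
Qed.

Lemma tassoc_bilin U V W :
  bilin (fun (s : tensor U V) (z : W) => sw s (fun x y => x ⊗ (y ⊗ z))).
Proof.
split=> [z|s].
  apply: lin_sw; first exact: lin_id.
  by apply: bilin_tens; [apply: lin_id | apply: tens_linearl].
apply: lin_sw_fun => x y.
by apply: lin_comp; apply: tens_linearr.
Qed.

Lemma tassoc_linear U V W : linear (@tassoc K U V W).
Proof. by apply: lin_sw; [apply: lin_id | apply: tassoc_bilin]. Qed.

Lemma tassoc_tens U V W (x : U) (y : V) (z : W) :
  tassoc ((x ⊗ y) ⊗ z) = x ⊗ (y ⊗ z).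
Proof.
rewrite /tassoc (sw_tens (tassoc_bilin U V W)) sw_tens //.
by apply: bilin_tens; [apply: lin_id | apply: tens_linearl].
Qed.

End LinearMaps.

(** * Shuffles and cuts of words *)

Section Shuffles.
Variable T : eqType.
Implicit Types (x y z w : seq T) (a b : T).

(** Words are meant to be read backwards here: the head of a list stands for
    the last letter of a permutation, so that the letter on which the
    half-products depend is the one exposed by recursion on lists. The nested
    fixpoint makes both [shuffles x' y] and [shuffles x y'] structural. *)
Fixpoint shuffles x : seq T -> seq (seq T) :=
  if x is a :: x' then
    fix shuffles_x y := if y is b :: y' then
      map (cons a) (shuffles x' y) ++ map (cons b) (shuffles_x y')
      else [:: x]
  else fun y => [:: y].

(** The half-shuffles, according to the word that provides the head:
    [shuffles_l] underlies the left half-product and [shuffles_r] the right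
    one. *)
Definition shuffles_l x y :=
  if x is a :: x' then map (cons a) (shuffles x' y) else [::].

Definition shuffles_r x y :=
  if y is b :: y' then map (cons b) (shuffles x y') else [::].

(* Simplification would expose the inner fixpoint. *)
Arguments shuffles : simpl never.

Lemma shuffles_cons a x b y : shuffles (a :: x) (b :: y) =
  map (cons a) (shuffles x (b :: y)) ++ map (cons b) (shuffles (a :: x) y).
Proof. by []. Qed.

Lemma shuffless0 x : shuffles x [::] = [:: x]. Proof. by case: x. Qed.

Lemma shufflesE x y : (x != [::]) || (y != [::]) ->
  shuffles x y = shuffles_l x y ++ shuffles_r x y.
Proof. by case: x y => [|a x] [|b y] //= _; rewrite !shuffless0. Qed.

Lemma shuffles_perm x y w : w \in shuffles x y -> perm_eq w (x ++ y).
Proof.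
elim: x y w => [|a x IHx] y w; first by rewrite inE => /eqP->.
elim: y w => [|b y IHy] w; first by rewrite inE cats0 => /eqP->.
rewrite shuffles_cons mem_cat => /orP[] /mapP[v v_in ->].
  by rewrite perm_cons IHx.
have e := perm_catCA (a :: x) [:: b] y.
by rewrite perm_sym (e (b :: v)) perm_cons perm_sym IHy.
Qed.

Lemma shuffles_l_sub x y : {subset shuffles_l x y <= shuffles x y}.
Proof.
by move=> w; case: x => // a x w_in; rewrite shufflesE // mem_cat w_in.
Qed.

Lemma shuffles_r_sub x y : {subset shuffles_r x y <= shuffles x y}.
Proof.
move=> w; case: y => // b y w_in.
by rewrite shufflesE ?orbT // mem_cat w_in orbT.
Qed.

(** When no letter is repeated, the head of [w] tells from which word it was
    taken, so nothing but the relative order of the letters of each word has to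
    be checked. This is what relates recursive shuffles to the monotony
    conditions that define shuffle permutations. *)
Lemma shufflesP x y w : uniq (x ++ y) ->
  reflect [/\ perm_eq w (x ++ y), subseq x w & subseq y w]
          (w \in shuffles x y).
Proof.
move=> Uxy; apply: (iffP idP).
  move=> w_in; split; first exact: shuffles_perm.
    elim: x y w w_in {Uxy} => [|a x IHx] y w; first by rewrite sub0seq.
    elim: y w => [|b y IHy] w; first by rewrite inE => /eqP->.
    rewrite shuffles_cons mem_cat => /orP[] /mapP[v v_in ->].
      by rewrite /= eqxx (IHx _ _ v_in).
    exact: subseq_trans (IHy _ v_in) (subseq_cons _ _).
  elim: x y w w_in {Uxy} => [|a x IHx] y w; first by rewrite inE => /eqP->.
  elim: y w => [|b y IHy] w; first by rewrite sub0seq.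
  rewrite shuffles_cons mem_cat => /orP[] /mapP[v v_in ->].
    exact: subseq_trans (IHx _ _ v_in) (subseq_cons _ _).
  by rewrite /= eqxx IHy.
elim: w x y Uxy => [|c w IHw] x y Uxy [].
  by rewrite perm_sym => /perm_nilP; case: x y {Uxy} => [|a x] [|b y].
move=> eq_w sx sy; have Uw : uniq (c :: w) by rewrite (perm_uniq eq_w).
have c_in : c \in x ++ y by rewrite -(perm_mem eq_w) mem_head.
have cNw : c \notin w by case/andP: Uw.
case: x Uxy eq_w sx c_in => [|a x] Uxy eq_w sx c_in.
  rewrite /= inE eq_sym; have := size_subseq_leqif sy.
  by move=> <-; rewrite (perm_size eq_w).
have [eq_ca|neq_ca] := eqVneq a c.
  rewrite -{}eq_ca in eq_w sx sy cNw *.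
  apply: shuffles_l_sub; apply: map_f; apply: IHw; first by case/andP: Uxy.
  split; first by move: eq_w; rewrite cat_cons perm_cons.
    by move: sx; rewrite /= eqxx.
  case: y Uxy sy {eq_w c_in} => [|b y]; first by rewrite !sub0seq.
  rewrite /=; have [->|//] := eqVneq b a.
  by rewrite mem_cat mem_head orbT.
have c_x : c \notin a :: x.
  apply: contra cNw => /(mem_subseq _); apply.
  by move: sx; rewrite /= (negPf neq_ca).
move: c_in; rewrite mem_cat (negPf c_x) orFb.
case: y Uxy eq_w sy => [|b y] // Uxy eq_w sy c_in.
have [eq_cb|neq_cb] := eqVneq b c; last first.
  move: sy; rewrite /= (negPf neq_cb) => /mem_subseq/(_ _ c_in).
  by rewrite (negPf cNw).
rewrite -{}eq_cb in eq_w sx sy cNw neq_ca *.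
apply: shuffles_r_sub; apply: map_f; apply: IHw.
  by move: Uxy; rewrite !cat_uniq => /and3P[-> /= /norP[_ ->] /andP[_ ->]].
split.
- have e := perm_catCA (a :: x) [:: b] y.
  by move: eq_w; rewrite perm_sym (e (b :: w)) perm_cons perm_sym.
- by move: sx; rewrite /= (negPf neq_ca).
- by move: sy; rewrite /= eqxx.
Qed.

Lemma shuffles_uniq x y : uniq (x ++ y) -> uniq (shuffles x y).
Proof.
have cons_inj a : injective (cons a) by move=> s t [].
elim: x y => [|a x IHx] //; elim=> [|b y IHy] // Uxy.
rewrite shuffles_cons cat_uniq !map_inj_uniq ?IHx //; last 1 first.
- by case/andP: Uxy.
rewrite IHy ?andbT; last first.
  by move: Uxy; rewrite !cat_uniq => /and3P[-> /= /norP[_ ->] /andP[_ ->]].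
apply/hasPn => _ /mapP[v _ ->]; apply/mapP => -[u _ [eq_ba _]].
by move: Uxy; rewrite eq_ba /= mem_cat mem_head orbT.
Qed.

(** With disjoint alphabets, the head of a shuffle determines its origin. *)
Lemma shuffles_lE a x y : ohead x = Some a -> a \notin y ->
  shuffles_l x y = [seq w <- shuffles x y | ohead w == Some a].
Proof.
case: x => // _ x [->] aNy; rewrite shufflesE // filter_cat filter_map.
rewrite (@eq_filter _ _ predT) => [|w]; last by rewrite /= eqxx.
rewrite filter_predT; case: y aNy => [|b y] aNy; first by rewrite cats0.
rewrite filter_map (@eq_filter _ _ pred0) => [|w /=].
  by rewrite filter_pred0 cats0.
by apply: contraNF aNy => /eqP[<-]; rewrite mem_head.
Qed.

Lemma shuffles_rE b x y : ohead y = Some b -> b \notin x ->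
  shuffles_r x y = [seq w <- shuffles x y | ohead w == Some b].
Proof.
case: y => // _ y [->] bNx; rewrite shufflesE ?orbT // filter_cat.
rewrite [in X in _ ++ X]filter_map.
rewrite [in X in _ ++ X](@eq_filter _ _ predT) => [|w]; last by rewrite /= eqxx.
rewrite filter_predT; case: x bNx => [|a x] bNx //.
rewrite filter_map (@eq_filter _ _ pred0) => [|w /=].
  by rewrite filter_pred0.
by apply: contraNF bNx => /eqP[->]; rewrite mem_head.
Qed.

(** Deconcatenations, including the two trivial ones. *)
Fixpoint cuts w : seq (seq T * seq T) :=
  if w is a :: w' then
    ([::], w) :: [seq (a :: c.1, c.2) | c <- cuts w']
  else [:: ([::], [::])].

Lemma cutsE w : cuts w = [seq (take i w, drop i w) | i <- iota 0 (size w).+1].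
Proof.
elim: w => // a w IHw; rewrite [LHS]/= {}IHw -map_comp.
have -> : iota 0 (size (a :: w)).+1 = 0%N :: map succn (iota 0 (size w).+1).
  by rewrite -(iotaDl 1 0).
by rewrite map_cons -map_comp.
Qed.

Lemma cuts_cat w c : c \in cuts w -> w = c.1 ++ c.2.
Proof. by rewrite cutsE => /mapP[i _ ->]; rewrite cat_take_drop. Qed.

Section Sums.
Variable M : nmodType.

Lemma sum_shuffles_cons a x b y (f : seq T -> M) :
  \sum_(w <- shuffles (a :: x) (b :: y)) f w =
  \sum_(w <- shuffles x (b :: y)) f (a :: w)
  + \sum_(w <- shuffles (a :: x) y) f (b :: w).
Proof. by rewrite shuffles_cons big_cat !big_map. Qed.

Lemma sum_cuts_cons a w (f : seq T * seq T -> M) :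
  \sum_(c <- cuts (a :: w)) f c =
  f ([::], a :: w) + \sum_(c <- cuts w) f (a :: c.1, c.2).
Proof. by rewrite [cuts _]/= big_cons big_map. Qed.

(** A shuffle of [a :: x] with the first piece of a cut of [b :: y] starts with
    [a], or with [b] when this piece is nonempty; what remains is then a
    shuffle with the first piece of a cut of [y]. *)
Lemma sum_cuts_shuffles_cons a x b y (f : seq T -> seq T -> M) :
  \sum_(d <- cuts (b :: y)) \sum_(p <- shuffles (a :: x) d.1) f p d.2 =
  \sum_(d <- cuts (b :: y)) \sum_(p <- shuffles x d.1) f (a :: p) d.2
  + \sum_(d <- cuts y) \sum_(p <- shuffles (a :: x) d.1) f (b :: p) d.2.
Proof.
rewrite !sum_cuts_cons /= !shuffless0 !big_seq1 -addrA; congr (_ + _).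
rewrite -big_split; apply: eq_bigr => d _.
exact: (sum_shuffles_cons a x b d.1 (f^~ d.2)).
Qed.

(** Both sides run over the shuffles of three words. Sorting these by the word
    that provides the head leaves three instances of the induction hypothesis. *)
Lemma shufflesA x y z (f : seq T -> M) :
  \sum_(w <- shuffles x y) \sum_(t <- shuffles w z) f t =
  \sum_(w <- shuffles y z) \sum_(t <- shuffles x w) f t.
Proof.
elim: x y z f => [|a x IHx] y z f.
  by rewrite big_seq1; apply: eq_bigr => w _; rewrite big_seq1.
elim: y z f => [|b y IHy] z f; first by rewrite !big_seq1.
elim: z f => [|c z IHz] f.
  rewrite shuffless0 big_seq1; apply: eq_bigr => w _.
  by rewrite shuffless0 big_seq1.
have Ia := IHx (b :: y) (c :: z) (fun t => f (a :: t)).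
have Ib := IHy (c :: z) (fun t => f (b :: t)).
have Ic := IHz (fun t => f (c :: t)).
rewrite sum_shuffles_cons.
under eq_bigr do rewrite sum_shuffles_cons.
under [X in _ + X = _]eq_bigr do rewrite sum_shuffles_cons.
rewrite !big_split /= addrACA Ia Ib -(sum_shuffles_cons _ _ _ _
  (fun w => \sum_(t <- shuffles w z) f (c :: t))) Ic.
rewrite [in RHS]sum_shuffles_cons.
under [X in _ = X + _]eq_bigr do rewrite sum_shuffles_cons.
under [X in _ = _ + X]eq_bigr do rewrite sum_shuffles_cons.
by rewrite !big_split /= [in LHS](sum_shuffles_cons b y) -[LHS]addrA addrACA.
Qed.

(** Both sides run over the ways to cut [w] into three pieces. *)
Lemma cutsA w (f : seq T -> seq T -> seq T -> M) :
  \sum_(c <- cuts w) \sum_(d <- cuts c.1) f d.1 d.2 c.2 =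
  \sum_(c <- cuts w) \sum_(d <- cuts c.2) f c.1 d.1 d.2.
Proof.
elim: w f => [|a w IHw] f; first by rewrite !big_seq1.
rewrite !sum_cuts_cons big_seq1.
under eq_bigr do rewrite sum_cuts_cons.
by rewrite big_split /= -addrA -(IHw (fun p q r => f (a :: p) q r)).
Qed.
(** Cutting a shuffle is the same as cutting the two words and shuffling the
    first pieces and the second pieces: the compatibility of product and
    coproduct from which the four bidendriform identities follow. *)
Lemma cuts_shuffles x y (f : seq T -> seq T -> M) :
  \sum_(w <- shuffles x y) \sum_(c <- cuts w) f c.1 c.2 =
  \sum_(c <- cuts x) \sum_(d <- cuts y)
    \sum_(p <- shuffles c.1 d.1) \sum_(q <- shuffles c.2 d.2) f p q.
Proof.
elim: x y f => [|a x IHx] y f.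
  rewrite !big_seq1 /=; apply: eq_bigr => d _.
  by rewrite !big_seq1.
elim: y f => [|b y IHy] f.
  rewrite !big_seq1; apply: eq_bigr => d _.
  by rewrite big_seq1 !shuffless0 !big_seq1.
rewrite sum_shuffles_cons.
under eq_bigr do rewrite sum_cuts_cons.
under [X in _ + X = _]eq_bigr do rewrite sum_cuts_cons.
rewrite !big_split /= addrACA -(sum_shuffles_cons _ _ _ _ (f [::])).
rewrite (IHx (b :: y) (fun p q => f (a :: p) q)).
rewrite (IHy (fun p q => f (b :: p) q)) [in RHS]sum_cuts_cons.
under [X in _ = _ + X]eq_bigr => c _.
  rewrite (sum_cuts_shuffles_cons _ _ _ _
             (fun p d2 => \sum_(q <- shuffles c.2 d2) f p q)).
  over.
rewrite big_split [in LHS](sum_cuts_cons a x) /= !addrA.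
congr (_ + _); rewrite addrAC; congr (_ + _).
rewrite (sum_cuts_cons b y) /= !big_seq1; congr (_ + _).
by apply: eq_bigr => d _; rewrite !big_seq1.
Qed.

(** The head of a shuffle stays the head of the first piece of each of its
    cuts, as long as this piece is nonempty, which the vanishing of [f]
    enforces; so only the shuffles of first pieces become half-shuffles. *)
Lemma cuts_shuffles_l x y (f : seq T -> seq T -> M) :
  (forall q, f [::] q = 0) ->
  \sum_(w <- shuffles_l x y) \sum_(c <- cuts w) f c.1 c.2 =
  \sum_(c <- cuts x) \sum_(d <- cuts y)
    \sum_(p <- shuffles_l c.1 d.1) \sum_(q <- shuffles c.2 d.2) f p q.
Proof.
move=> f0; case: x => [|a x].
  by rewrite big_nil big_seq1 big1 //= => d _; rewrite big_nil.
rewrite big_map sum_cuts_cons [X in _ = X + _]big1 ?add0r => [|d _]; last first.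
  by rewrite big_nil.
under eq_bigr do rewrite sum_cuts_cons f0 add0r.
rewrite (cuts_shuffles _ _ (fun p q => f (a :: p) q)).
by apply: eq_bigr => c _; apply: eq_bigr => d _; rewrite big_map.
Qed.

Lemma cuts_shuffles_r x y (f : seq T -> seq T -> M) :
  (forall q, f [::] q = 0) ->
  \sum_(w <- shuffles_r x y) \sum_(c <- cuts w) f c.1 c.2 =
  \sum_(c <- cuts x) \sum_(d <- cuts y)
    \sum_(p <- shuffles_r c.1 d.1) \sum_(q <- shuffles c.2 d.2) f p q.
Proof.
move=> f0; case: y => [|b y].
  by rewrite big_nil big1 //= => c _; rewrite big_seq1 big_nil.
rewrite big_map; under eq_bigr do rewrite sum_cuts_cons f0 add0r.
rewrite (cuts_shuffles _ _ (fun p q => f (b :: p) q)).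
apply: eq_bigr => c _; rewrite sum_cuts_cons big_nil add0r.
by apply: eq_bigr => d _; rewrite big_map.
Qed.

End Sums.
End Shuffles.

(** * Words, standardization and basis elements *)

Section Words.
Implicit Types (w : seq nat) (f : nat -> nat).

Lemma size_word n (u : 'S_n) : size (word u) = n.
Proof. by rewrite size_map size_enum_ord. Qed.

Lemma nth_word n (u : 'S_n) (i : 'I_n) : nth 0%N (word u) i = (u i).+1.
Proof. by rewrite (nth_map i) ?size_enum_ord // nth_ord_enum. Qed.

Lemma word_uniq n (u : 'S_n) : uniq (word u).
Proof.
by rewrite map_inj_uniq ?enum_uniq // => i j /succn_inj/val_inj/perm_inj.
Qed.

Lemma perm_word n (u : 'S_n) : perm_eq (word u) (iota 1 n).
Proof.
apply: uniq_perm; rewrite ?word_uniq ?iota_uniq // => k.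
rewrite mem_iota add1n ltnS; apply/mapP/idP => [[i _ ->]|/andP[k0 kn]].
  exact: ltn_ord.
case: k k0 kn => // k _ kn; exists (u^-1 (Ordinal kn))%g.
  by rewrite mem_enum.
by rewrite permKV.
Qed.

Lemma word_inj n : injective (@word n).
Proof.
move=> u v eq_uv; apply/permP => i; apply/val_inj/succn_inj.
by rewrite -!nth_word eq_uv.
Qed.

Definition letter_rank w a := count (fun x => (x < a)%N) w.
(** The word of [st w], as a plain list: computing with it avoids the type
    ['S_(size w)], which depends on the word. *)
Definition std w := [seq (letter_rank w a).+1 | a <- w].

Lemma word_st w : uniq w -> word (st w) = std w.
Proof.
move=> Uw; rewrite /std -[X in map _ X](mkseq_nth 0%N w) /mkseq.
rewrite -val_enum_ord -2!map_comp; apply: eq_map => i /=.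
by rewrite stE.
Qed.

Lemma std_perm w n : perm_eq w (iota 1 n) -> std w = w.
Proof.
move=> pw; rewrite -[RHS]map_id; apply/eq_in_map => a.
rewrite (perm_mem pw) mem_iota add1n ltnS => /andP[a0 an].
rewrite /letter_rank (seq.permP pw) -size_filter.
suff -> : [seq x <- iota 1 n | (x < a)%N] = iota 1 a.-1.
  by rewrite size_iota prednK.
apply: (irr_sorted_eq ltn_trans ltnn); rewrite ?iota_ltn_sorted //.
  by apply: sorted_filter (iota_ltn_sorted _ _); apply: ltn_trans.
move=> x; rewrite mem_filter !mem_iota !add1n prednK // !ltnS.
case: ltnP => [lt_xa|_]; last by rewrite andbF.
by rewrite (leq_trans (ltnW lt_xa) an).
Qed.

Lemma perm_word_exists w n :
  perm_eq w (iota 1 n) -> exists t : 'S_n, word t = w.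
Proof.
move=> pw; have Uw : uniq w by rewrite (perm_uniq pw) iota_uniq.
have <- : size w = n by rewrite (perm_size pw) size_iota.
by exists (st w); rewrite word_st // (std_perm pw).
Qed.

Lemma letter_rank_mono w : {in w &, {mono letter_rank w : a b / (a < b)%N}}.
Proof.
move=> a b aw bw; have [lt_ab|le_ba] := ltnP a b; last first.
  apply/negbTE; rewrite -leqNgt; apply: sub_count => x /= lt_xb.
  exact: leq_trans lt_xb le_ba.
rewrite /letter_rank -!size_filter.
have -> : [seq x <- w | (x < a)%N] =
          [seq x <- [seq x <- w | (x < b)%N] | (x < a)%N].
  rewrite -filter_predI; apply: eq_filter => x /=.
  by case: (ltnP x a) => // lt_xa; rewrite (ltn_trans lt_xa lt_ab).
rewrite size_filter ltn_neqAle count_size andbT -all_count.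
by apply/allPn; exists a; rewrite ?mem_filter ?lt_ab // ltnn.
Qed.

Lemma std_map (f : nat -> nat) w :
  {in w &, {mono f : a b / (a < b)%N}} -> std (map f w) = std w.
Proof.
move=> fm; rewrite /std -map_comp; apply/eq_in_map => a aw /=.
rewrite /letter_rank count_map; congr _.+1; apply: eq_in_count => x xw /=.
exact: fm.
Qed.

Lemma mono_ltn_inj (f : nat -> nat) w :
  {in w &, {mono f : a b / (a < b)%N}} -> {in w &, injective f}.
Proof.
move=> fm a b aw bw eq_f; apply/eqP.
have := fm b a bw aw; have := fm a b aw bw; rewrite eq_f ltnn.
by case: ltngtP.
Qed.

Variable K : fieldType.

(** Comparing words instead of permutations gives access to basis elements
    indexed by permutations whose sizes are only provably equal. *)
Lemma F_word n m (u : 'S_n) (v : 'S_m) : word u = word v -> F K u = F K v.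
Proof.
move=> eq_uv; have eq_nm : n = m by rewrite -(size_word u) eq_uv size_word.
by case: m / eq_nm v eq_uv => v /word_inj->.
Qed.

Lemma F_st w n (u : 'S_n) : uniq w -> word u = std w -> F K (st w) = F K u.
Proof. by move=> Uw eq_u; apply: F_word; rewrite word_st. Qed.

(** The basis element of the standardization of a reversed word. All the
    structure maps are computed on these elements, with arbitrary distinct
    letters, because pieces of permutations are not permutations. As [F]
    vanishes in size 0, so does [Frev] on the empty word; hence trivial cuts
    may be added to or removed from sums of tensors freely. *)
Definition Frev w : FQSym_plus K := F K (st (rev w)).

Lemma Frev0 : Frev [::] = 0. Proof. by []. Qed.

Lemma Frev_word n (u : 'S_n) : Frev (rev (word u)) = F K u.
Proof.
rewrite /Frev revK; apply: (F_st (word_uniq u)).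
by rewrite (std_perm (perm_word u)).
Qed.

(** Only the relative order of the letters matters. *)
Lemma Frev_map (f : nat -> nat) w : uniq w ->
  {in w &, {mono f : a b / (a < b)%N}} -> Frev (map f w) = Frev w.
Proof.
move=> Uw fm; rewrite /Frev -map_rev.
have fm' : {in rev w &, {mono f : a b / (a < b)%N}}.
  by move=> a b; rewrite !mem_rev; apply: fm.
apply: F_word; rewrite !word_st ?rev_uniq ?std_map //.
by rewrite map_inj_in_uniq ?rev_uniq //; apply: mono_ltn_inj.
Qed.

Lemma FrevE w : uniq w -> w != [::] ->
  exists n (u : 'S_n.+1),
    [/\ size w = n.+1, word u = rev (std w) & Frev w = F K u].
Proof.
move=> Uw; rewrite -size_eq0; case sw : (size w) => [|n] // _.
have [u eq_u] : exists u : 'S_n.+1, word u = std (rev w).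
  apply: perm_word_exists; have := perm_word (st (rev w)).
  by rewrite word_st ?rev_uniq // size_rev sw.
exists n, u; split=> //; last by apply: F_st; rewrite ?rev_uniq.
rewrite eq_u /std -map_rev; apply: eq_map => a.
by rewrite /letter_rank count_rev.
Qed.

End Words.

(** * Shuffle permutations and shuffles of words *)

Section ShufflePermutations.

Lemma subseq_nth_sorted (s p : seq nat) : uniq s -> all (gtn (size s)) p ->
  subseq [seq nth 0%N s i | i <- p] s = sorted ltn p.
Proof.
move=> Us /allP ps; apply/idP/idP => [sub|p_sorted].
  have e_s : map (index^~ s) s = iota 0 (size s).
    rewrite -[X in map _ X = _](mkseq_nth 0%N s) -map_comp -[RHS]map_id.
    apply/eq_in_map => i; rewrite mem_iota add0n => /andP[_ lt_is] /=.
    by rewrite index_uniq.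
  have e_p : map (index^~ s) [seq nth 0%N s i | i <- p] = p.
    rewrite -map_comp -[RHS]map_id; apply/eq_in_map => i /ps lt_is /=.
    by rewrite index_uniq.
  rewrite -e_p; apply: subseq_sorted ltn_trans _ _ (map_subseq _ sub) _.
  by rewrite e_s iota_ltn_sorted.
rewrite -[X in subseq _ X](mkseq_nth 0%N s); apply: map_subseq.
suff -> : p = [seq i <- iota 0 (size s) | i \in p] by apply: filter_subseq.
apply: (irr_sorted_eq ltn_trans ltnn) => //.
  by apply: sorted_filter (iota_ltn_sorted _ _); apply: ltn_trans.
move=> i; rewrite mem_filter mem_iota add0n /=.
by apply/idP/andP => [ip|[]//]; split=> //; apply: ps.
Qed.

Lemma sorted_enum_ord n (f : 'I_n -> nat) :
  sorted ltn [seq f i | i <- enum 'I_n] =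
  [forall i : 'I_n, forall j : 'I_n, (i < j)%N ==> (f i < f j)%N].
Proof.
rewrite sorted_map; apply/idP/forallP => [f_sorted i|f_inc].
  apply/forallP => j; apply/implyP => lt_ij.
  have tr : transitive (relpre f ltn) by move=> a b c; apply: ltn_trans.
  have := sorted_ltn_nth tr i f_sorted; move/(_ i j).
  by rewrite !inE size_enum_ord !ltn_ord !nth_ord_enum; apply.
apply: (@sub_sorted _ (relpre val ltn)) => [i j lt_ij|].
  by have /forallP/(_ j)/implyP := f_inc i; apply.
by rewrite -sorted_map val_enum_ord iota_ltn_sorted.
Qed.

Section Bijection.
Variables (n m : nat) (u : 'S_n) (v : 'S_m).

Lemma cross_lshift i : cross u v (lshift m i) = lshift m (u i).
Proof.
rewrite permE /cross_fun.
case: (split_ordP (lshift m i)) => [j /lshift_inj<- //|j].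
by move/eqP; rewrite eq_lrshift.
Qed.

Lemma cross_rshift i : cross u v (rshift n i) = rshift n (v i).
Proof.
rewrite permE /cross_fun.
case: (split_ordP (rshift n i)) => [j|j /rshift_inj<- //].
by move/eqP; rewrite eq_rlshift.
Qed.

(** The permutation [z] sends a position in the concatenated word to the
    position of the same letter in the shuffled word [t], so it is increasing
    on a block of positions exactly when the letters of this block keep their
    order in [t]. *)
Lemma mem_sh (z : 'S_(n + m)) :
  (z \in sh n m) =
  subseq (word u) (word (z^-1 * cross u v)%g) &&
  subseq (map (addn n) (word v)) (word (z^-1 * cross u v)%g).
Proof.
set t := (z^-1 * cross u v)%g.
have eX : word u =
    [seq nth 0%N (word t) i | i <- [seq val (z (lshift m i)) | i <- enum 'I_n]].
  rewrite -map_comp; apply: eq_map => i /=.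
  by rewrite nth_word permM permK cross_lshift.
have eY : map (addn n) (word v) =
    [seq nth 0%N (word t) i | i <- [seq val (z (rshift n i)) | i <- enum 'I_m]].
  rewrite -!map_comp; apply: eq_map => i /=.
  by rewrite nth_word permM permK cross_rshift /= addnS.
rewrite eX eY !subseq_nth_sorted ?word_uniq // ?sorted_enum_ord ?inE //.
all: by apply/allP => _ /mapP[i _ ->] /=; rewrite size_word ltn_ord.
Qed.

Lemma perm_iota_cat :
  perm_eq (word u ++ map (addn n) (word v)) (iota 1 (n + m)).
Proof.
rewrite iotaD [(1 + n)%N]addnC iotaDl; apply: perm_cat (perm_word u) _.
exact: perm_map (perm_word v).
Qed.

(** Shuffles of words with distinct letters are enumerated without repetition
    on both sides, so it suffices to compare members. A shuffle [w] of the two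
    words is the word of some [t], and then [cross u v * t^-1] is the shuffle
    permutation that produces it. *)
Lemma sh_shuffles :
  perm_eq [seq rev (word (z^-1 * cross u v)%g) | z in sh n m]
          (shuffles (rev (word u)) (rev (map (addn n) (word v)))).
Proof.
set X := word u; set Y := map _ _.
have pXY : perm_eq (rev X ++ rev Y) (iota 1 (n + m)).
  by apply: perm_trans perm_iota_cat; apply: perm_cat; rewrite perm_rev.
have Uxy : uniq (rev X ++ rev Y) by rewrite (perm_uniq pXY) iota_uniq.
apply: uniq_perm; last 1 first.
- move=> w; apply/idP/(shufflesP _ Uxy) => [/imageP[z z_in ->]|[pw sX sY]].
    move: z_in; rewrite (mem_sh z) -/X -/Y !subseq_rev => /andP[-> ->].
    split=> //.
    rewrite perm_sym; apply: perm_trans pXY _.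
    by rewrite perm_sym perm_rev perm_word.
  have [t eq_t] : exists t : 'S_(n + m), word t = rev w.
    by apply: perm_word_exists; rewrite perm_rev (perm_trans pw).
  apply/imageP; exists (cross u v * t^-1)%g.
    rewrite mem_sh invMg invgK mulgKV eq_t -/X -/Y.
    by rewrite -[X]revK -[Y]revK !subseq_rev sX.
  by rewrite invMg invgK mulgKV eq_t revK.
- rewrite map_inj_uniq ?enum_uniq // => z z' /(can_inj revK)/word_inj/mulIg.
  exact: invg_inj.
- exact: shuffles_uniq.
Qed.

End Bijection.
End ShufflePermutations.

(** * Half-products of basis elements *)

Section FProducts.
Variable K : fieldType.

Lemma shuffles_map (T T' : eqType) (f : T -> T') x y :
  shuffles (map f x) (map f y) = map (map f) (shuffles x y).
Proof.
elim: x y => [|a x IHx] //; elim=> [|b y IHy]; first by rewrite !shuffless0.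
rewrite !map_cons !shuffles_cons map_cat -!map_comp -map_cons IHx -map_comp.
by rewrite -(map_cons f a x) IHy -map_comp.
Qed.

Lemma shuffles_l_map (T T' : eqType) (f : T -> T') x y :
  shuffles_l (map f x) (map f y) = map (map f) (shuffles_l x y).
Proof. by case: x => //= a x; rewrite shuffles_map -!map_comp. Qed.

Lemma shuffles_r_map (T T' : eqType) (f : T -> T') x y :
  shuffles_r (map f x) (map f y) = map (map f) (shuffles_r x y).
Proof. by case: y => //= b y; rewrite shuffles_map -!map_comp. Qed.

Lemma ohead_rev_word n (t : 'S_n) (i : 'I_n) :
  i.+1 = n -> ohead (rev (word t)) = Some (t i).+1.
Proof.
move=> en; rewrite -nth_word; have := size_word t; rewrite -[in RHS]en.
case/lastP: (word t) => // s a; rewrite size_rcons rev_rcons => -[<-] /=.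
by rewrite nth_rcons ltnn eqxx.
Qed.

(** The position [i] is the last one, so the condition prescribes the last
    letter of the shuffled word, that is, the head of its reversal. *)
Lemma sum_F_sh n m (u : 'S_n) (v : 'S_m) (i : 'I_(n + m)) (j : 'I_(n + m)) :
  i.+1 = (n + m)%N ->
  \sum_(z in sh n m | (z^-1)%g i == j) F K (z^-1 * cross u v)%g =
  \sum_(w <- shuffles (rev (word u)) (rev (map (addn n) (word v)))
        | ohead w == Some (cross u v j).+1) Frev K w.
Proof.
move=> ei; rewrite -(perm_big _ (sh_shuffles u v)) big_image_cond.
apply: eq_big => [z|z _]; last by rewrite Frev_word.
rewrite (ohead_rev_word _ ei) permM; congr (_ && _).
by apply/eqP/eqP => [->//|[/val_inj/perm_inj]].
Qed.

Lemma letter_rank_cat x y a :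
  letter_rank (x ++ y) a = (letter_rank x a + letter_rank y a)%N.
Proof. exact: count_cat. Qed.

Section Below.
Variables x y : seq nat.
Hypothesis lt_xy : allrel ltn x y.

(** Standardizing a concatenation in which the second alphabet lies above the
    first amounts to standardizing both words and shifting the second one: this
    is the word of [cross u v]. *)
Lemma std_cat : std (x ++ y) = std x ++ map (addn (size x)) (std y).
Proof.
rewrite /std map_cat -map_comp; congr (_ ++ _); apply/eq_in_map => a a_in /=.
  rewrite letter_rank_cat [X in (_ + X)%N](_ : _ = 0)%N ?addn0 //.
  apply/eqP; rewrite -leqn0 leqNgt -has_count; apply/hasPn => b b_in.
  by rewrite -leqNgt ltnW //; apply: (allrelP lt_xy).
rewrite letter_rank_cat addnS; congr (_ + _).+1.
by apply/eqP; rewrite -all_count; apply/allP => b b_in; apply: (allrelP lt_xy).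
Qed.

End Below.

Section Product.
Variables x y : seq nat.
Hypotheses (Ux : uniq x) (Uy : uniq y) (x0 : x != [::]) (y0 : y != [::]).
Hypothesis lt_xy : allrel ltn x y.

Lemma uniq_cat_below : uniq (x ++ y).
Proof.
rewrite cat_uniq Ux Uy andbT /=; apply/hasPn => b by_; apply/negP => bx.
by have := allrelP lt_xy _ _ bx by_; rewrite /= ltnn.
Qed.

Let f a := (letter_rank (x ++ y) a).+1.

Lemma std_below : std x = map f x /\ map (addn (size x)) (std y) = map f y.
Proof.
have /eqP := std_cat lt_xy; rewrite {1}/std map_cat eqseq_cat ?size_map //.
by case/andP=> /eqP<- /eqP<-.
Qed.

Lemma Frev_shuffle w : perm_eq w (x ++ y) -> Frev K (map f w) = Frev K w.
Proof.
move=> pw; apply: Frev_map; first by rewrite (perm_uniq pw) uniq_cat_below.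
move=> a b aw bw; rewrite ltnS -(letter_rank_mono (w := x ++ y)) //.
  by rewrite -(perm_mem pw).
by rewrite -(perm_mem pw).
Qed.

Lemma uniq_map_f : uniq (map f x ++ map f y).
Proof.
rewrite -map_cat map_inj_in_uniq ?uniq_cat_below //.
apply: mono_ltn_inj => a b a_in b_in; rewrite ltnS.
exact: (letter_rank_mono (w := x ++ y)).
Qed.

(** The two factors are first replaced by permutations, which relabels [x ++ y]
    increasingly by [f]; [Frev] does not see the relabelling. *)
Lemma fq_prec_Frev :
  fq_prec (Frev K x ⊗ Frev K y) = \sum_(w <- shuffles_l x y) Frev K w.
Proof.
have [n [u [sx eq_u ->]]] := FrevE K Ux x0.
have [m [v [_ eq_v ->]]] := FrevE K Uy y0.
have [fx fy] := std_below; rewrite sx in fy.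
rewrite fq_precE /F_prec sum_F_sh; last by rewrite /= addnS.
rewrite -map_rev eq_u eq_v !revK cross_lshift.
rewrite fy fx -big_filter /=.
have head_x : ohead (map f x) = Some (u ord_max).+1.
  by rewrite -fx -[std x]revK -eq_u (@ohead_rev_word _ _ ord_max).
rewrite -(shuffles_lE head_x); last first.
  have := uniq_map_f; rewrite cat_uniq => /and3P[_ /hasPn disj _].
  apply/negP => /disj/negP; apply.
  by case: (map f x) head_x => //= a s [->]; rewrite mem_head.
rewrite shuffles_l_map big_map !big_seq; apply: eq_bigr => w w_in.
by rewrite Frev_shuffle // shuffles_perm // shuffles_l_sub.
Qed.

Lemma fq_succ_Frev :
  fq_succ (Frev K x ⊗ Frev K y) = \sum_(w <- shuffles_r x y) Frev K w.
Proof.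
have [n [u [sx eq_u ->]]] := FrevE K Ux x0.
have [m [v [_ eq_v ->]]] := FrevE K Uy y0.
have [fx fy] := std_below; rewrite sx in fy.
rewrite fq_succE /F_succ sum_F_sh; last by rewrite /= addnS.
rewrite -map_rev eq_u eq_v !revK cross_rshift.
rewrite fy fx -big_filter /=.
have head_y : ohead (map f y) = Some (n.+1 + v ord_max).+1.
  rewrite -fy; have : ohead (std y) = Some (v ord_max).+1.
    by rewrite -[std y]revK -eq_v (@ohead_rev_word _ _ ord_max).
  by case: (std y) => //= a s [->]; rewrite addnS.
rewrite -(shuffles_rE head_y); last first.
  have := uniq_map_f; rewrite cat_uniq => /and3P[_ /hasPn + _]; apply.
  by case: (map f y) head_y => //= a s [->]; rewrite mem_head.
rewrite shuffles_r_map big_map !big_seq; apply: eq_bigr => w w_in.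
by rewrite Frev_shuffle // shuffles_perm // shuffles_r_sub.
Qed.

Lemma dmul_Frev :
  dmul (@fq_prec K) (@fq_succ K) (Frev K x) (Frev K y) =
  \sum_(w <- shuffles x y) Frev K w.
Proof.
by rewrite /dmul fq_prec_Frev fq_succ_Frev shufflesE ?x0 // big_cat.
Qed.

End Product.
End FProducts.

(** * Half-coproducts of basis elements *)

Section MaxLetter.
Implicit Types (w : seq nat).

Definition max_letter w := \max_(a <- w) a.

Lemma leq_max_letter w a : a \in w -> (a <= max_letter w)%N.
Proof. by move=> aw; apply: (leq_bigmax_seq (F := id)). Qed.

Lemma mem_max_letter w : w != [::] -> max_letter w \in w.
Proof.
rewrite /max_letter; elim: w => // a [|b w] IHw _.
  by rewrite big_seq1 mem_head.
rewrite big_cons inE; case: (leqP a (\max_(j <- b :: w) j)) => [le|lt].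
  by rewrite IHw ?orbT.
by rewrite eqxx.
Qed.

(** A piece that contains the largest letter of a word has the same largest
    letter; the conditions in nested half-coproducts thus bear on one letter. *)
Lemma max_letter_sub w s : {subset s <= w} -> max_letter w \in s ->
  max_letter s = max_letter w.
Proof.
move=> sub max_s; apply/eqP; rewrite eqn_leq (leq_max_letter max_s) andbT.
by apply: leq_max_letter; apply: sub; apply: mem_max_letter; case: (s) max_s.
Qed.

Lemma letter_rank_max w : uniq w -> w != [::] ->
  (letter_rank w (max_letter w)).+1 = size w.
Proof.
move=> Uw /mem_max_letter max_w.
rewrite -(count_predC (pred1 (max_letter w))) count_uniq_mem // max_w add1n.
congr _.+1; apply: eq_in_count => a aw /=.
by rewrite ltn_neqAle leq_max_letter // andbT.
Qed.

End MaxLetter.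

Section Coproducts.
Variable K : fieldType.

Lemma F_st_nil s : s = [::] -> F K (st s) = 0.
Proof. by move->. Qed.

Section Cuts.
Variables (w : seq nat) (n : nat) (u : 'S_n.+1).
Hypotheses (Uw : uniq w) (sw : size w = n.+1) (eq_u : word u = rev (std w)).

Lemma F_cut_Frev i : (i <= n.+1)%N ->
  F_cut K u i = Frev K (drop (n.+1 - i) w) ⊗ Frev K (take (n.+1 - i) w).
Proof.
move=> le_i; pose f a := (letter_rank w a).+1.
have fm : {in w &, {mono f : a b / (a < b)%N}}.
  by move=> a b aw bw; rewrite ltnS; apply: letter_rank_mono.
have Ff s : subseq s w -> F K (st (rev (map f s))) = Frev K s.
  move=> sub; have := mem_subseq sub => msub.
  apply: (Frev_map K (subseq_uniq sub Uw)) => a b /msub aw /msub bw.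
  exact: fm.
rewrite /F_cut eq_u take_rev drop_rev /std size_map sw -map_drop -map_take.
by rewrite !Ff ?drop_subseq ?take_subseq.
Qed.

(** Reversal exchanges the position [p] with [n - p], counted from 0, and the
    prefix of length [n.+1 - j] with the complement of [take j w]. *)
Lemma max_posE j : (j <= n.+1)%N ->
  (max_pos u <= n.+1 - j)%N = (max_letter w \notin take j w).
Proof.
move=> le_j; have w0 : w != [::] by rewrite -size_eq0 sw.
have max_w := mem_max_letter w0.
have p_lt : (index (max_letter w) w < n.+1)%N by rewrite -sw index_mem.
have -> : max_pos u = (n.+1 - index (max_letter w) w)%N.
  have q_lt : (n - index (max_letter w) w < n.+1)%N by rewrite ltnS leq_subr.
  rewrite /max_pos subSn //; congr _.+1.
  suff -> : (u^-1)%g ord_max = Ordinal q_lt by [].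
  apply: (canLR (permK u)); apply/val_inj/succn_inj; rewrite -nth_word eq_u /=.
  rewrite nth_rev size_map sw ?subSS ?subKn //.
  by rewrite (nth_map 0%N) ?sw // nth_index // letter_rank_max.
rewrite in_take // -leqNgt.
by rewrite leq_sub2lE // ltnW.
Qed.

(** The summation range includes both trivial cuts, which contribute 0; it is
    thus symmetric under the reversal of words. *)
Lemma sum_F_cut (P : pred nat) (Q : pred (seq nat)) :
  (forall j, (j <= n.+1)%N -> P (n.+1 - j)%N = Q (take j w)) ->
  \sum_(0 <= i < n.+2 | P i) F_cut K u i =
  \sum_(c <- cuts w | Q c.1) Frev K c.2 ⊗ Frev K c.1.
Proof.
move=> PQ; rewrite big_nat_rev /= add0n cutsE big_map sw /index_iota subn0.
rewrite [LHS]big_seq_cond [RHS]big_seq_cond.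
apply: eq_big => [j|j /andP[j_in _]].
  rewrite subSS; case: (boolP (j \in _)) => //.
  by rewrite mem_iota => /andP[_ le_j]; rewrite PQ.
have le_j : (j <= n.+1)%N by move: j_in; rewrite mem_iota.
by rewrite subSS (F_cut_Frev (leq_subr _ _)) (subKn le_j).
Qed.

End Cuts.

Lemma fq_Dprec_Frev w : uniq w ->
  fq_Dprec (Frev K w) =
  \sum_(c <- cuts w | max_letter w \notin c.1) Frev K c.2 ⊗ Frev K c.1.
Proof.
have [-> _|w0 Uw] := eqVneq w [::].
  rewrite big_cons big_nil !Frev0 tens0l addr0 /=.
  by rewrite [LHS]linear0.
have [n [u [sw eq_u ->]]] := FrevE K Uw w0; rewrite fq_DprecE /F_Dprec.
rewrite -(@sum_F_cut w n u Uw sw eq_u (fun i => max_pos u <= i)%N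
   (fun s => max_letter w \notin s)); last exact: max_posE.
rewrite (@big_nat_widenl _ _ _ _ 0%N) // [LHS]big_mkcond [RHS]big_mkcond.
rewrite [RHS]big_nat_recr //= [F_cut K u n.+1]/F_cut.
rewrite (@F_st_nil (drop _ _)) ?tens0r.
  by rewrite if_same addr0.
by apply: drop_oversize; rewrite size_word.
Qed.

Lemma fq_Dsucc_Frev w : uniq w ->
  fq_Dsucc (Frev K w) =
  \sum_(c <- cuts w | max_letter w \in c.1) Frev K c.2 ⊗ Frev K c.1.
Proof.
have [-> _|w0 Uw] := eqVneq w [::].
  by rewrite big_cons big_nil [LHS]linear0.
have [n [u [sw eq_u ->]]] := FrevE K Uw w0; rewrite fq_DsuccE /F_Dsucc.
rewrite -(@sum_F_cut w n u Uw sw eq_u (fun i => i < max_pos u)%N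
   (fun s => max_letter w \in s)); last first.
  by move=> j le_j; rewrite ltnNge (max_posE Uw sw eq_u) // negbK.
rewrite -(big_nat_widen _ _ _ predT); last first.
  by rewrite /max_pos ltnS ltnW // ltn_ord.
rewrite [RHS]big_ltn // /F_cut take0 F_st_nil // tens0l add0r.
by [].
Qed.

End Coproducts.

(** * Extension from basis elements by linearity *)

Section Extension.
Variable K : fieldType.
Local Notation A := (FQSym_plus K).
Local Notation G := (Frev K).
Implicit Types U V W : lmodType K.

Lemma FQSym_plusE (x : A) :
  x = \sum_(t <- msupp x) x@_t *: F K (tagged t).
Proof.
rewrite [LHS](monalgE x); apply: eq_bigr => -[n u] _.
apply/malgP => t; rewrite mcoeffZ [F K _]/(<< _ >>) !mcoeffU.
by rewrite mulr_natr.
Qed.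

Lemma F_above m n (u : 'S_n.+1) :
  exists w, [/\ uniq w, w != [::], all (ltn m) w & F K u = G w].
Proof.
exists (map (addn m) (rev (word u))); split.
- by rewrite map_inj_uniq ?rev_uniq ?word_uniq //; apply: addnI.
- by rewrite -size_eq0 size_map size_rev size_word.
- apply/allP => _ /mapP[a a_in ->]; move: a_in.
  by rewrite mem_rev => /mapP[i _ ->] /=; rewrite addnS ltnS leq_addr.
- rewrite Frev_map ?rev_uniq ?word_uniq ?Frev_word // => a b _ _.
  by rewrite ltn_add2l.
Qed.

(** The bound [m] makes it possible to choose words on successive disjoint
    alphabets when the lemma is used for several arguments in turn. *)
Lemma lin_eq U m (f g : A -> U) : linear f -> linear g ->
  (forall w, uniq w -> w != [::] -> all (ltn m) w -> f (G w) = g (G w)) ->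
  f =1 g.
Proof.
move=> lf lg fg x; rewrite [x]FQSym_plusE (lin_sum lf) (lin_sum lg).
apply: eq_bigr => -[n u] _; rewrite ![tagged _]/=.
have [w [Uw w0 lt_w ->]] := F_above m u.
have := lf x@_(existT _ n u) (G w) 0; have := lg x@_(existT _ n u) (G w) 0.
by rewrite (lin0 lf) (lin0 lg) !addr0 fg // => -> ->.
Qed.

Lemma allrel_max x y : all (ltn (max_letter x)) y -> allrel ltn x y.
Proof.
move=> /allP lt_y; apply/allrelP => a b ax /lt_y; apply: leq_ltn_trans.
exact: leq_max_letter.
Qed.

(** The situation in which a half-product is a sum over half-shuffles. *)
Definition words2 x y :=
  [/\ uniq x, uniq y, x != [::], y != [::] & allrel ltn x y].

Lemma bilin_eq U (f g : A -> A -> U) : bilin f -> bilin g ->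
  (forall x y, words2 x y -> f (G x) (G y) = g (G x) (G y)) ->
  forall a b, f a b = g a b.
Proof.
move=> [fl fr] [gl gr] fg a b.
apply: (lin_eq (m := 0) (f := f^~ b) (g := g^~ b)) => // x Ux x0 _.
apply: (lin_eq (m := max_letter x) (f := f (G x)) (g := g (G x))) => //.
move=> y Uy y0 lt_y.
by apply: fg; split=> //; apply: allrel_max.
Qed.

End Extension.

(** * The dendriform algebra *)

Section HalfShufflesAssoc.
Variables (T : eqType) (M : nmodType) (x y z : seq T) (f : seq T -> M).

(** Removing the common head, which comes from [x], [y] or [z] in the three
    lemmas respectively, leaves the associativity of shuffles. *)
Lemma shuffles_llA :
  \sum_(w <- shuffles_l x y) \sum_(t <- shuffles_l w z) f t =
  \sum_(w <- shuffles y z) \sum_(t <- shuffles_l x w) f t.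
Proof.
case: x => [|a x']; first by rewrite big_nil big1 // => w _; rewrite big_nil.
rewrite big_map; under eq_bigr do rewrite big_map.
by rewrite shufflesA; apply: eq_bigr => w _; rewrite big_map.
Qed.

Lemma shuffles_rlA :
  \sum_(w <- shuffles_r x y) \sum_(t <- shuffles_l w z) f t =
  \sum_(w <- shuffles_l y z) \sum_(t <- shuffles_r x w) f t.
Proof.
case: y => [|b y']; first by rewrite !big_nil.
rewrite !big_map; under eq_bigr do rewrite big_map.
by rewrite shufflesA; apply: eq_bigr => w _; rewrite big_map.
Qed.

Lemma shuffles_rrA :
  \sum_(w <- shuffles x y) \sum_(t <- shuffles_r w z) f t =
  \sum_(w <- shuffles_r y z) \sum_(t <- shuffles_r x w) f t.
Proof.
case: z => [|c z'].
  by rewrite [RHS]big_nil big1 // => w _; rewrite big_nil.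
rewrite [RHS]big_map; under eq_bigr do rewrite big_map.
rewrite -(shufflesA x y z' (fun t => f (c :: t))).
by apply: eq_bigr => w _; rewrite big_map.
Qed.

End HalfShufflesAssoc.

Section Operations.
Variables (K : fieldType) (A X : lmodType K) (op : tensor A A -> A).
Hypothesis lop : linear op.

Lemma lin_opl (f : X -> A) b : linear f -> linear (fun x => op (f x ⊗ b)).
Proof.
move=> lf; apply: (@lin_comp K _ _ _ op) lop _.
exact: (@lin_comp K _ _ _ (fun x => x ⊗ b) f (tens_linearl _)).
Qed.

Lemma lin_opr (f : X -> A) a : linear f -> linear (fun x => op (a ⊗ f x)).
Proof.
move=> lf; apply: (@lin_comp K _ _ _ op) lop _.
exact: (@lin_comp K _ _ _ (fun x => a ⊗ x) f (tens_linearr _)).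
Qed.

Lemma op_suml I (r : seq I) (E : I -> A) b :
  op ((\sum_(i <- r) E i) ⊗ b) = \sum_(i <- r) op (E i ⊗ b).
Proof.
by rewrite (lin_sum (@tens_linearl K _ _ b)) (lin_sum lop).
Qed.

Lemma op_sumr I (r : seq I) (E : I -> A) a :
  op (a ⊗ (\sum_(i <- r) E i)) = \sum_(i <- r) op (a ⊗ E i).
Proof.
by rewrite (lin_sum (@tens_linearr K _ _ a)) (lin_sum lop).
Qed.

End Operations.

Section FreeQuasiSymmetric.
Variable K : fieldType.
Local Notation A := (FQSym_plus K).
Local Notation G := (Frev K).
Local Notation prec := (@fq_prec K).
Local Notation succ := (@fq_succ K).
Local Notation mul := (dmul prec succ).

Lemma fq_prec_linear : linear prec.
Proof. exact: (sw_linear (bilin_extP _)). Qed.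

Lemma fq_succ_linear : linear succ.
Proof. exact: (sw_linear (bilin_extP _)). Qed.

Lemma fq_Dprec_linear : linear (@fq_Dprec K).
Proof. exact: lin_ext_linear. Qed.

Lemma fq_Dsucc_linear : linear (@fq_Dsucc K).
Proof. exact: lin_ext_linear. Qed.

Lemma perm_allrel_l x y z w : perm_eq w (x ++ y) ->
  allrel ltn x z -> allrel ltn y z -> allrel ltn w z.
Proof.
move=> pw lt_xz lt_yz; rewrite (@eq_allrel_meml _ _ _ w (x ++ y)).
  by rewrite allrel_catl lt_xz.
by move=> a; rewrite (perm_mem pw).
Qed.

Lemma perm_allrel_r x y z w : perm_eq w (y ++ z) ->
  allrel ltn x y -> allrel ltn x z -> allrel ltn x w.
Proof.
move=> pw lt_xy lt_xz; rewrite (@eq_allrel_memr _ _ _ _ w (y ++ z)).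
  by rewrite allrel_catr lt_xy.
by move=> a; rewrite (perm_mem pw).
Qed.

Definition words3 x y z :=
  [/\ words2 x y, words2 y z & allrel ltn x z].

Lemma perm_cat_nil (x y w : seq nat) :
  perm_eq w (x ++ y) -> x != [::] -> w != [::].
Proof. by move/perm_size; case: w x => [|? ?] [|? ?]. Qed.

Lemma words2_perm_l x y z w : words3 x y z -> perm_eq w (x ++ y) -> words2 w z.
Proof.
move=> [[Ux Uy x0 y0 lt_xy] [_ Uz _ z0 lt_yz] lt_xz] pw; split=> //.
- by rewrite (perm_uniq pw) uniq_cat_below.
- exact: perm_cat_nil pw x0.
- exact: perm_allrel_l pw lt_xz lt_yz.
Qed.

Lemma words2_perm_r x y z w : words3 x y z -> perm_eq w (y ++ z) -> words2 x w.
Proof.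
move=> [[Ux Uy x0 y0 lt_xy] [_ Uz _ z0 lt_yz] lt_xz] pw; split=> //.
- by rewrite (perm_uniq pw) uniq_cat_below.
- exact: perm_cat_nil pw y0.
- exact: perm_allrel_r pw lt_xy lt_xz.
Qed.

Lemma mul_words x y :
  words2 x y -> mul (G x) (G y) = \sum_(w <- shuffles x y) G w.
Proof. by case=> *; apply: dmul_Frev. Qed.

(** The two half-products are treated at once wherever they behave alike. *)
Definition half_product (op : tensor A A -> A)
    (H : seq nat -> seq nat -> seq (seq nat)) : Prop :=
  (op = prec /\ H = @shuffles_l nat) \/ (op = succ /\ H = @shuffles_r nat).

Lemma product_words (op : tensor A A -> A) H :
  half_product op H ->
  [/\ linear op,
      forall x y, words2 x y -> op (G x ⊗ G y) = \sum_(w <- H x y) G w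
    & forall x y w, w \in H x y -> perm_eq w (x ++ y)].
Proof.
case=> -[-> ->]; split.
- exact: fq_prec_linear.
- by move=> x y [*]; apply: fq_prec_Frev.
- by move=> x y w /shuffles_l_sub/shuffles_perm.
- exact: fq_succ_linear.
- by move=> x y [*]; apply: fq_succ_Frev.
- by move=> x y w /shuffles_r_sub/shuffles_perm.
Qed.

Lemma op_opl_words (op op' : tensor A A -> A) H H' x y z :
  half_product op H ->
  half_product op' H' ->
  words3 x y z ->
  op' (op (G x ⊗ G y) ⊗ G z) = \sum_(w <- H x y) \sum_(t <- H' w z) G t.
Proof.
move=> /product_words[_ opE pH] /product_words[lop' op'E _] xyz.
rewrite opE; last by case: xyz.
rewrite (op_suml lop') !big_seq; apply: eq_bigr => w /pH pw.
by rewrite op'E //; apply: words2_perm_l pw.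
Qed.

Lemma op_opr_words (op op' : tensor A A -> A) H H' x y z :
  half_product op H ->
  half_product op' H' ->
  words3 x y z ->
  op' (G x ⊗ op (G y ⊗ G z)) = \sum_(w <- H y z) \sum_(t <- H' x w) G t.
Proof.
move=> /product_words[_ opE pH] /product_words[lop' op'E _] xyz.
rewrite opE; last by case: xyz.
rewrite (op_sumr lop') !big_seq; apply: eq_bigr => w /pH pw.
by rewrite op'E //; apply: words2_perm_r pw.
Qed.

Lemma op_mull_words (op : tensor A A -> A) H x y z :
  half_product op H ->
  words3 x y z ->
  op (mul (G x) (G y) ⊗ G z) = \sum_(w <- shuffles x y) \sum_(t <- H w z) G t.
Proof.
move=> /product_words[lop opE _] xyz; rewrite mul_words; last by case: xyz.
rewrite (op_suml lop) !big_seq; apply: eq_bigr => w /shuffles_perm pw.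
by rewrite opE //; apply: words2_perm_l pw.
Qed.

Lemma op_mulr_words (op : tensor A A -> A) H x y z :
  half_product op H ->
  words3 x y z ->
  op (G x ⊗ mul (G y) (G z)) = \sum_(w <- shuffles y z) \sum_(t <- H x w) G t.
Proof.
move=> /product_words[lop opE _] xyz; rewrite mul_words; last by case: xyz.
rewrite (op_sumr lop) !big_seq; apply: eq_bigr => w /shuffles_perm pw.
by rewrite opE //; apply: words2_perm_r pw.
Qed.

Lemma mul_linearl b : linear (fun a : A => mul a b).
Proof.
exact: (lin_add (lin_opl fq_prec_linear b (@lin_id K A))
                (lin_opl fq_succ_linear b (@lin_id K A))).
Qed.

Lemma mul_linearr a : linear (fun b : A => mul a b).
Proof.
exact: (lin_add (lin_opr fq_prec_linear a (@lin_id K A))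
                (lin_opr fq_succ_linear a (@lin_id K A))).
Qed.

Definition trilin (f : A -> A -> A -> A) : Prop :=
  (forall c, bilin (fun a b => f a b c)) /\ (forall a b, linear (f a b)).

(** Letters of the third word are chosen above both other alphabets. *)
Lemma trilin_eq (f g : A -> A -> A -> A) : trilin f -> trilin g ->
  (forall x y z, words3 x y z -> f (G x) (G y) (G z) = g (G x) (G y) (G z)) ->
  forall a b c, f a b c = g a b c.
Proof.
move=> [bf lf] [bg lg] fg a b c.
apply: (bilin_eq (bf c) (bg c)) => x y xy.
have [Ux Uy x0 y0 lt_xy] := xy.
apply: (lin_eq (m := maxn (max_letter x) (max_letter y)) (lf _ _) (lg _ _)).
move=> z Uz z0 /allP lt_z; apply: fg; split=> //.
  split=> //; apply: allrel_max; apply/allP => k /lt_z /=.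
  by rewrite gtn_max => /andP[].
by apply: allrel_max; apply/allP => k /lt_z /=; rewrite gtn_max => /andP[].
Qed.

Section Trilinear.
Variables op op' : tensor A A -> A.
Hypotheses (lop : linear op) (lop' : linear op').

Lemma trilin_op_opl : trilin (fun a b c => op' (op (a ⊗ b) ⊗ c)).
Proof.
split=> [c|a b]; last exact: (lin_opr lop' _ (@lin_id K A)).
split=> [b|a]; first exact: (lin_opl lop' c (lin_opl lop b (@lin_id K A))).
exact: (lin_opl lop' c (lin_opr lop a (@lin_id K A))).
Qed.

Lemma trilin_op_opr : trilin (fun a b c => op' (a ⊗ op (b ⊗ c))).
Proof.
split=> [c|a b]; last exact: (lin_opr lop' a (lin_opr lop b (@lin_id K A))).
split=> [b|a]; first exact: (lin_opl lop' _ (@lin_id K A)).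
exact: (lin_opr lop' a (lin_opl lop c (@lin_id K A))).
Qed.

Lemma trilin_op_mull : trilin (fun a b c => op (mul a b ⊗ c)).
Proof.
split=> [c|a b]; last exact: (lin_opr lop _ (@lin_id K A)).
split=> [b|a]; first exact: (lin_opl lop c (mul_linearl b)).
exact: (lin_opl lop c (mul_linearr a)).
Qed.

Lemma trilin_op_mulr : trilin (fun a b c => op (a ⊗ mul b c)).
Proof.
split=> [c|a b]; last exact: (lin_opr lop a (mul_linearr b)).
split=> [b|a]; first exact: (lin_opl lop _ (@lin_id K A)).
exact: (lin_opr lop a (mul_linearl c)).
Qed.

End Trilinear.

Lemma FQSym_dendriform_algebra : dendriform_algebra prec succ.
Proof.
have lp := fq_prec_linear; have ls := fq_succ_linear.
have pl : half_product prec (@shuffles_l nat) by left.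
have sr : half_product succ (@shuffles_r nat) by right.
split; [exact: lp | exact: ls | | |].
- apply: (trilin_eq (trilin_op_opl lp lp) (trilin_op_mulr lp)) => x y z xyz.
  apply: (etrans (op_opl_words pl pl xyz)).
  by rewrite shuffles_llA; apply: esym (op_mulr_words pl xyz).
- apply: (trilin_eq (trilin_op_opl ls lp) (trilin_op_opr lp ls)) => x y z xyz.
  apply: (etrans (op_opl_words sr pl xyz)).
  by rewrite shuffles_rlA; apply: esym (op_opr_words pl sr xyz).
- apply: (trilin_eq (trilin_op_mull ls) (trilin_op_opr ls ls)) => x y z xyz.
  apply: (etrans (op_mull_words sr xyz)).
  by rewrite shuffles_rrA; apply: esym (op_opr_words sr sr xyz).
Qed.

End FreeQuasiSymmetric.

(** * The dendriform coalgebra *)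

Section Coalgebra.
Variable K : fieldType.
Local Notation A := (FQSym_plus K).
Local Notation G := (Frev K).
Local Notation Dprec := (@fq_Dprec K).
Local Notation Dsucc := (@fq_Dsucc K).
Local Notation Dt := (Dtilde Dprec Dsucc).

(** The three coproducts differ only in the cuts they retain. Because of the
    reversal, [c.1] is the right tensor factor, and [P w p] is a condition on
    the part of [w] that goes to the right. *)
Definition cut_coproduct (D : A -> tensor A A) (P : rel (seq nat)) : Prop :=
  linear D /\ forall w, uniq w ->
    D (G w) = \sum_(c <- cuts w | P w c.1) G c.2 ⊗ G c.1.

Lemma cut_Dprec : cut_coproduct Dprec (fun w p => max_letter w \notin p).
Proof. by split=> [|w Uw]; [apply: fq_Dprec_linear | apply: fq_Dprec_Frev]. Qed.

Lemma cut_Dsucc : cut_coproduct Dsucc (fun w p => max_letter w \in p).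
Proof. by split=> [|w Uw]; [apply: fq_Dsucc_linear | apply: fq_Dsucc_Frev]. Qed.

Lemma cut_Dtilde : cut_coproduct Dt (fun _ _ => true).
Proof.
split=> [|w Uw]; first exact: lin_add (@fq_Dprec_linear K) (@fq_Dsucc_linear K).
rewrite /Dtilde fq_Dprec_Frev // fq_Dsucc_Frev // addrC.
by rewrite [RHS](bigID (fun c => max_letter w \in c.1)).
Qed.

Lemma cuts_uniq (w : seq nat) c : uniq w -> c \in cuts w ->
  uniq c.1 /\ uniq c.2.
Proof.
by move=> Uw /cuts_cat ew; move: Uw; rewrite ew cat_uniq => /and3P[].
Qed.

Section Iterated.
Variables (D D' : A -> tensor A A) (P P' : rel (seq nat)).
Hypotheses (DP : cut_coproduct D P) (DP' : cut_coproduct D' P').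
Variables (w : seq nat) (Uw : uniq w).

Lemma tassoc_tmap_cuts :
  tassoc (tmap D' id (D (G w))) =
  \sum_(c <- cuts w) \sum_(d <- cuts c.2)
    if P w c.1 && P' c.2 d.1 then G d.2 ⊗ (G d.1 ⊗ G c.1) else 0.
Proof.
have [lD DE] := DP; have [lD' DE'] := DP'.
rewrite DE // (lin_sum (tmap_linear lD' (@lin_id K A))).
rewrite (lin_sum (@tassoc_linear K _ _ _)) big_mkcond.
rewrite big_seq [RHS]big_seq; apply: eq_bigr => c c_in.
have [_ Uc] := cuts_uniq Uw c_in.
case: ifP => _; last by rewrite big1.
rewrite (tmap_tens _ _ lD' (@lin_id K A)) DE' //.
rewrite (lin_sum (@tens_linearl K _ _ (G c.1))).
rewrite (lin_sum (@tassoc_linear K _ _ _)) big_mkcond.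
by apply: eq_bigr => d _; rewrite tassoc_tens.
Qed.

Lemma tmap_cuts :
  tmap id D' (D (G w)) =
  \sum_(c <- cuts w) \sum_(d <- cuts c.1)
    if P w c.1 && P' c.1 d.1 then G c.2 ⊗ (G d.2 ⊗ G d.1) else 0.
Proof.
have [lD DE] := DP; have [lD' DE'] := DP'.
rewrite DE // (lin_sum (tmap_linear (@lin_id K A) lD')) big_mkcond.
rewrite big_seq [RHS]big_seq; apply: eq_bigr => c c_in.
have [Uc _] := cuts_uniq Uw c_in.
case: ifP => _; last by rewrite big1.
rewrite (tmap_tens _ _ (@lin_id K A) lD') DE' //.
by rewrite (lin_sum (@tens_linearr K _ _ (G c.2))) big_mkcond.
Qed.

End Iterated.

(** Both iterated coproducts run over the cuts of a word into three pieces [p],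
    [q], [r], by [cutsA], so an identity between them reduces to the
    equivalence of the conditions under which a triple is retained. *)
Lemma cut_coassoc D1 D1' D2 D2' P1 P1' P2 P2' :
  cut_coproduct D1 P1 -> cut_coproduct D1' P1' ->
  cut_coproduct D2 P2 -> cut_coproduct D2' P2' ->
  (forall p q r, P1 (p ++ q ++ r) p && P1' (q ++ r) q =
                 P2 (p ++ q ++ r) (p ++ q) && P2' (p ++ q) p) ->
  forall a, tassoc (tmap D1' id (D1 a)) = tmap id D2' (D2 a).
Proof.
move=> DP1 DP1' DP2 DP2' eqP; have [l1 _] := DP1; have [l1' _] := DP1'.
have [l2 _] := DP2; have [l2' _] := DP2'.
apply: (lin_eq (m := 0)) => [||w Uw _ _].
- apply: lin_comp (@tassoc_linear K _ _ _) _.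
  exact: lin_comp (tmap_linear l1' (@lin_id K A)) l1.
- exact: lin_comp (tmap_linear (@lin_id K A) l2') l2.
rewrite (tassoc_tmap_cuts DP1 DP1' Uw) (tmap_cuts DP2 DP2' Uw).
pose f p q r : tensor A (tensor A A) :=
  if P1 (p ++ q ++ r) p && P1' (q ++ r) q then G r ⊗ (G q ⊗ G p) else 0.
transitivity (\sum_(c <- cuts w) \sum_(d <- cuts c.2) f c.1 d.1 d.2).
  rewrite big_seq [RHS]big_seq; apply: eq_bigr => c /cuts_cat ->.
  rewrite big_seq [RHS]big_seq; apply: eq_bigr => d /cuts_cat e.
  by rewrite /f -e.
apply: etrans (esym (cutsA w f)) _.
rewrite big_seq [RHS]big_seq; apply: eq_bigr => c /cuts_cat ->.
rewrite big_seq [RHS]big_seq; apply: eq_bigr => d /cuts_cat e.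
by rewrite /f eqP catA -e.
Qed.

Lemma max_letter_catl p q : max_letter (p ++ q) \in p ->
  max_letter p = max_letter (p ++ q).
Proof. by apply: max_letter_sub => a; rewrite mem_cat => ->. Qed.

Lemma max_letter_catr p q : max_letter (p ++ q) \notin p ->
  max_letter q = max_letter (p ++ q).
Proof.
case: (eqVneq (p ++ q) [::]) => [|pq0].
  by case: p => //= ->.
move=> max_p; apply: max_letter_sub => [a|]; first by rewrite mem_cat orbC => ->.
by have := mem_max_letter pq0; rewrite mem_cat (negPf max_p).
Qed.

(** In terms of the piece that contains the largest letter of the whole word,
    the three identities retain the cuts with this letter in [r], [q] and [p]
    respectively. *)
Lemma FQSym_dendriform_coalgebra : dendriform_coalgebra Dprec Dsucc.
Proof.
split; [exact: fq_Dprec_linear | exact: fq_Dsucc_linear | | | ].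
- apply: (cut_coassoc cut_Dprec cut_Dprec cut_Dprec cut_Dtilde) => p q r.
  rewrite andbT mem_cat negb_or; apply: andb_id2l => max_p.
  by rewrite (max_letter_catr max_p).
- apply: (cut_coassoc cut_Dprec cut_Dsucc cut_Dsucc cut_Dprec) => p q r.
  rewrite mem_cat; have [max_p|max_p] /= := boolP (_ \in p).
    rewrite catA in max_p; have max_pq : max_letter ((p ++ q) ++ r) \in p ++ q.
      by rewrite mem_cat max_p.
    by rewrite (max_letter_catl max_pq) max_p.
  rewrite (max_letter_catr max_p) catA; have [max_q|//] := boolP (_ \in q).
  have max_pq : max_letter ((p ++ q) ++ r) \in p ++ q.
    by rewrite mem_cat max_q orbT.
  by rewrite (max_letter_catl max_pq) -catA max_p.
- apply: (cut_coassoc cut_Dsucc cut_Dtilde cut_Dsucc cut_Dsucc) => p q r.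
  rewrite andbT catA; have [max_pq|max_pq] /= := boolP (_ \in p ++ q).
    by rewrite (max_letter_catl max_pq).
  by apply: contraNF max_pq; rewrite mem_cat => ->.
Qed.

End Coalgebra.

(** * Compatibility of products and coproducts *)

Section InnerCuts.
Variable T : eqType.
Implicit Types (w : seq T).

Definition inner_cuts w := [seq c <- cuts w | (c.1 != [::]) && (c.2 != [::])].

Lemma inner_cutsP w c : c \in inner_cuts w ->
  [/\ w = c.1 ++ c.2, c.1 != [::] & c.2 != [::]].
Proof. by rewrite mem_filter => /andP[/andP[? ?] /cuts_cat]. Qed.

Variable M : nmodType.

Lemma sum_cuts_nil1 w (f : seq T * seq T -> M) :
  \sum_(c <- cuts w | c.1 == [::]) f c = f ([::], w).
Proof.
case: w => [|a w]; first by rewrite big_cons big_nil addr0.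
by rewrite [cuts _]/= big_cons big_map big_pred0 ?addr0.
Qed.

Lemma sum_cuts_nil2 w (f : seq T * seq T -> M) :
  \sum_(c <- cuts w | c.2 == [::]) f c = f (w, [::]).
Proof.
elim: w f => [|a w IHw] f; first by rewrite big_cons big_nil addr0.
by rewrite [cuts _]/= big_cons big_map (IHw (fun c => f (a :: c.1, c.2))).
Qed.

Lemma sum_inner_cuts w (f : seq T * seq T -> M) : w != [::] ->
  \sum_(c <- cuts w) f c =
  f ([::], w) + f (w, [::]) + \sum_(c <- inner_cuts w) f c.
Proof.
move=> w0; rewrite (bigID (fun c => c.1 == [::])) sum_cuts_nil1 /=.
rewrite (bigID (fun c => c.2 == [::])) -(sum_cuts_nil2 w f) /= addrA big_filter.
congr (_ + _ + _); rewrite big_seq_cond [RHS]big_seq_cond.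
apply: eq_bigl => -[p q] /=; case: (boolP (_ \in _)) => //= /cuts_cat /= e.
case: (eqVneq q [::]) => [q0|]; last by rewrite andbF.
by move: w0; rewrite e q0 cats0 => ->.
Qed.

End InnerCuts.

Section Compatibility.
Variable K : fieldType.
Local Notation A := (FQSym_plus K).
Local Notation G := (Frev K).
Local Notation prec := (@fq_prec K).
Local Notation succ := (@fq_succ K).
Local Notation mul := (dmul prec succ).
Local Notation Dprec := (@fq_Dprec K).
Local Notation Dsucc := (@fq_Dsucc K).
Local Notation Dt := (Dtilde Dprec Dsucc).

Lemma cut_coproduct_inner D P w : cut_coproduct (K := K) D P -> uniq w ->
  D (G w) = \sum_(c <- inner_cuts w | P w c.1) G c.2 ⊗ G c.1.
Proof.
move=> [_ DE] Uw; rewrite DE // big_mkcond [RHS]big_mkcond.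
have [->|w0] := eqVneq w [::].
  by rewrite big_seq1 big_nil [G _]Frev0 tens0l if_same.
by rewrite sum_inner_cuts //= [G [::]]Frev0 tens0l tens0r !if_same !add0r.
Qed.

Lemma sw_cut_coproduct (U : lmodType K) D P w (f : A -> A -> U) :
  cut_coproduct D P -> bilin f -> uniq w ->
  sw (D (G w)) f = \sum_(c <- inner_cuts w | P w c.1) f (G c.2) (G c.1).
Proof.
move=> DP bf Uw; rewrite (cut_coproduct_inner DP Uw) (lin_sum (sw_linear bf)).
by apply: eq_bigr => c _; apply: sw_tens.
Qed.

Section Terms.
Variables (op : tensor A A -> A) (D : A -> tensor A A).
Hypotheses (lop : linear op) (lD : linear D).

Let lDt : linear Dt := proj1 (cut_Dtilde K).

Lemma bilin_op : bilin (fun a b => op (a ⊗ b)).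
Proof.
split=> ?; first exact: (lin_opl lop _ (@lin_id K A)).
exact: (lin_opr lop _ (@lin_id K A)).
Qed.

Lemma tens_comp_l (X V W : lmodType K) (f : X -> V) (y : W) :
  linear f -> linear (fun x => f x ⊗ y).
Proof. exact: (lin_comp (f := fun x => x ⊗ y) (@tens_linearl K _ _ y)). Qed.

Lemma tens_comp_r (X V W : lmodType K) (f : X -> W) (x : V) :
  linear f -> linear (fun y => x ⊗ f y).
Proof. exact: (lin_comp (f := fun y => x ⊗ y) (@tens_linearr K _ _ x)). Qed.

(** The terms of the bidendriform identities are named after the arguments that
    they cut. An argument that is not cut goes to the right tensor factor,
    except in [right_split_mul] and [left_split_mul], where it is multiplied
    into the left one. *)
Lemma both_split_inner a1 a2 : bilin (fun b1 b2 => mul a1 b1 ⊗ op (a2 ⊗ b2)).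
Proof. exact: (bilin_tens (mul_linearr a1) (bilin_op.2 a2)). Qed.

Lemma both_split_outer (t : tensor A A) :
  bilin (fun a1 a2 => sw t (fun b1 b2 => mul a1 b1 ⊗ op (a2 ⊗ b2))).
Proof.
split=> [a2|a1]; apply: lin_sw_fun => b1 b2.
  exact: (tens_comp_l _ (mul_linearl b1)).
exact: (tens_comp_r _ (bilin_op.1 b2)).
Qed.

Lemma both_split_bilin : bilin (fun a b =>
  sw (Dt a) (fun a1 a2 => sw (D b) (fun b1 b2 => mul a1 b1 ⊗ op (a2 ⊗ b2)))).
Proof.
split=> [b|a]; first exact: (lin_sw lDt (both_split_outer _)).
by apply: lin_sw_fun => a1 a2; apply: (lin_sw lD (both_split_inner _ _)).
Qed.

Lemma left_split_inner b : bilin (fun a1 a2 : A => a1 ⊗ op (a2 ⊗ b)).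
Proof. exact: (bilin_tens (@lin_id K A) (bilin_op.1 b)). Qed.

Lemma left_split_bilin : bilin (fun a b =>
  sw (Dt a) (fun a1 a2 => a1 ⊗ op (a2 ⊗ b))).
Proof.
split=> [b|a]; first exact: (lin_sw lDt (left_split_inner b)).
by apply: lin_sw_fun => a1 a2; apply: (tens_comp_r _ (bilin_op.2 a2)).
Qed.

Lemma right_split_inner a : bilin (fun b1 b2 : A => b1 ⊗ op (a ⊗ b2)).
Proof. exact: (bilin_tens (@lin_id K A) (bilin_op.2 a)). Qed.

Lemma right_split_bilin : bilin (fun a b =>
  sw (D b) (fun b1 b2 => b1 ⊗ op (a ⊗ b2))).
Proof.
split=> [b|a]; last exact: (lin_sw lD (right_split_inner a)).
by apply: lin_sw_fun => b1 b2; apply: (tens_comp_r _ (bilin_op.1 b2)).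
Qed.

Lemma right_split_mul_inner a : bilin (fun b1 b2 : A => mul a b1 ⊗ b2).
Proof. exact: (bilin_tens (mul_linearr a) (@lin_id K A)). Qed.

Lemma right_split_mul_bilin : bilin (fun a b =>
  sw (D b) (fun b1 b2 => mul a b1 ⊗ b2)).
Proof.
split=> [b|a]; last exact: (lin_sw lD (right_split_mul_inner a)).
by apply: lin_sw_fun => b1 b2; apply: (tens_comp_l _ (mul_linearl b1)).
Qed.

Lemma left_split_mul_inner b : bilin (fun a1 a2 : A => mul a1 b ⊗ a2).
Proof. exact: (bilin_tens (mul_linearl b) (@lin_id K A)). Qed.

Lemma left_split_mul_bilin : bilin (fun a b =>
  sw (Dt a) (fun a1 a2 => mul a1 b ⊗ a2)).
Proof.
split=> [b|a]; first exact: (lin_sw lDt (left_split_mul_inner b)).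
by apply: lin_sw_fun => a1 a2; apply: (tens_comp_l _ (mul_linearr a1)).
Qed.

Lemma bilin_coproduct : bilin (fun a b => D (op (a ⊗ b))).
Proof.
split=> c; first exact: (lin_comp lD (bilin_op.1 c)).
exact: (lin_comp lD (bilin_op.2 c)).
Qed.

End Terms.

Lemma bilin_add (U : lmodType K) (f g : A -> A -> U) : bilin f -> bilin g ->
  bilin (fun a b => f a b + g a b).
Proof.
move=> [fl fr] [gl gr]; split=> c; first exact: (lin_add (fl c) (gl c)).
exact: (lin_add (fr c) (gr c)).
Qed.

Section HalfProductCuts.
Variables (op : tensor A A -> A) (H : seq nat -> seq nat -> seq (seq nat)).
Variables (D : A -> tensor A A) (b : bool).
Hypotheses (opH : half_product op H)
  (Db : cut_coproduct D (fun w p => (max_letter w \in p) == b)).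
Variables (x y : seq nat).
Hypothesis xy : words2 x y.

(** The contribution of a cut of [x] and a cut of [y] to the coproduct of the
    half-product: full shuffles on the left, half-shuffles on the right. *)
Definition split_term (c d : seq nat * seq nat) : tensor A A :=
  (\sum_(q <- shuffles c.2 d.2) G q) ⊗ (\sum_(p <- H c.1 d.1) G p).

(** The second alphabet lies above the first. *)
Lemma max_letter_shuffle w : perm_eq w (x ++ y) -> max_letter w = max_letter y.
Proof.
case: xy => Ux Uy x0 y0 lt_xy pw; apply/esym/max_letter_sub => [a|].
  by rewrite (perm_mem pw) mem_cat orbC => ->.
have := mem_max_letter (perm_cat_nil pw x0).
rewrite (perm_mem pw) mem_cat => /orP[max_x|//].
have max_y := mem_max_letter y0.
have := allrelP lt_xy _ _ max_x max_y; rewrite /= ltnNge.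
by rewrite leq_max_letter // (perm_mem pw) mem_cat max_y orbT.
Qed.

Lemma max_letter_notin : max_letter y \notin x.
Proof.
case: xy => Ux Uy x0 y0 lt_xy; apply/negP => max_x.
by have := allrelP lt_xy _ _ max_x (mem_max_letter y0); rewrite /= ltnn.
Qed.

(** A cut of a shuffle is retained according to the piece that contains its
    largest letter. This letter comes from [y], so the condition bears on the
    cut of [y] alone, and [cuts_shuffles_l] or [cuts_shuffles_r] applies. *)
Lemma coproduct_half_product :
  D (op (G x ⊗ G y)) =
  \sum_(c <- cuts x) \sum_(d <- cuts y | (max_letter y \in d.1) == b)
    split_term c d.
Proof.
have [lop opE pH] := product_words opH; have [lD DE] := Db.
rewrite opE // (lin_sum lD).
pose f p q : tensor A A := if (max_letter y \in p) == b then G q ⊗ G p else 0.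
transitivity (\sum_(w <- H x y) \sum_(c <- cuts w) f c.1 c.2).
  rewrite big_seq [RHS]big_seq; apply: eq_bigr => w /pH pw.
  rewrite DE; last by rewrite (perm_uniq pw) uniq_cat_below //; case: xy.
  by rewrite big_mkcond (max_letter_shuffle pw).
have f0 q : f [::] q = 0 by rewrite /f [G [::]]Frev0 tens0r if_same.
transitivity (\sum_(c <- cuts x) \sum_(d <- cuts y)
    \sum_(p <- H c.1 d.1) \sum_(q <- shuffles c.2 d.2) f p q).
  by case: opH => -[_ ->]; [apply: cuts_shuffles_l | apply: cuts_shuffles_r].
rewrite big_seq [RHS]big_seq; apply: eq_bigr => c /cuts_cat ex.
rewrite [RHS]big_mkcond; apply: eq_bigr => d _.
have max_c : max_letter y \notin c.1.
  by apply: contra max_letter_notin; rewrite ex mem_cat => ->.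
have fE p q : p \in H c.1 d.1 ->
    f p q = if (max_letter y \in d.1) == b then G q ⊗ G p else 0.
  by move=> /pH pp; rewrite /f (perm_mem pp) mem_cat (negPf max_c).
transitivity (\sum_(p <- H c.1 d.1) \sum_(q <- shuffles c.2 d.2)
    if (max_letter y \in d.1) == b then G q ⊗ G p else 0).
  rewrite big_seq [RHS]big_seq; apply: eq_bigr => p p_in.
  by apply: eq_bigr => q _; apply: fE.
case: ((max_letter y \in d.1) == b); last by apply: big1 => p _; apply: big1.
rewrite /split_term (lin_sum (@tens_linearr K _ _ _)).
by apply: eq_bigr => p _; rewrite (lin_sum (@tens_linearl K _ _ _)).
Qed.

(** The trivial cut of [y] that leaves the largest letter on the prescribed
    side. *)
Let e := if b then (y, [::]) else ([::], y).

(** Distinguishing the two trivial cuts of [x], and the only trivial cut of [y]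
    that is retained, yields one sum for each possible term of the bidendriform
    identities. The terms absent from a given identity are those in which a
    half-shuffle would have to take its head from an empty word, or in which
    the left tensor factor would be empty. *)
Lemma coproduct_half_product_inner :
  D (op (G x ⊗ G y)) =
  \sum_(c <- inner_cuts x)
    \sum_(d <- inner_cuts y | (max_letter y \in d.1) == b) split_term c d
  + \sum_(c <- inner_cuts x) split_term c e
  + \sum_(d <- inner_cuts y | (max_letter y \in d.1) == b) split_term (x, [::]) d
  + \sum_(d <- inner_cuts y | (max_letter y \in d.1) == b) split_term ([::], x) d
  + split_term ([::], x) e
  + split_term (x, [::]) e.
Proof.
case: (xy) => _ _ x0 y0 _.
have sumE c : \sum_(d <- cuts y | (max_letter y \in d.1) == b) split_term c d =
    split_term c e
    + \sum_(d <- inner_cuts y | (max_letter y \in d.1) == b) split_term c d.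
  rewrite big_mkcond sum_inner_cuts // [in RHS]big_mkcond /= mem_max_letter //.
  by rewrite /e; case: (b); rewrite ?add0r ?addr0.
apply: (etrans coproduct_half_product).
apply: (etrans (sum_inner_cuts _ x0)).
apply: (etrans (congr2 +%R (congr2 +%R (sumE _) (sumE _))
                           (eq_bigr _ (fun c _ => sumE c)))).
rewrite big_split /=.
(* The summands are, in pairs, those of the cuts [([::], x)] and [(x, [::])] and
   of the inner cuts of [x], for [e] first and then for the inner cuts of [y]. *)
by rewrite (AC ((2*2)*2) (6*5*4*2*1*3)).
Qed.

Lemma words2_inner c d : c \in inner_cuts x -> d \in inner_cuts y ->
  words2 c.1 d.1 /\ words2 c.2 d.2.
Proof.
case: xy => Ux Uy x0 y0 lt_xy /inner_cutsP[ex c10 c20] /inner_cutsP[ey d10 d20].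
move: Ux Uy lt_xy; rewrite ex ey !cat_uniq => /and3P[? _ ?] /and3P[? _ ?].
by rewrite allrel_catl !allrel_catr => /andP[/andP[? _] /andP[_ ?]].
Qed.

Lemma words2_inner_l c : c \in inner_cuts x -> words2 c.1 y /\ words2 c.2 y.
Proof.
case: xy => Ux Uy x0 y0 lt_xy /inner_cutsP[ex c10 c20].
move: Ux lt_xy; rewrite ex !cat_uniq => /and3P[? _ ?].
by rewrite allrel_catl => /andP[? ?].
Qed.

Lemma words2_inner_r d : d \in inner_cuts y -> words2 x d.1 /\ words2 x d.2.
Proof.
case: xy => Ux Uy x0 y0 lt_xy /inner_cutsP[ey d10 d20].
move: Uy lt_xy; rewrite ey !cat_uniq => /and3P[? _ ?].
by rewrite allrel_catr => /andP[? ?].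
Qed.

End HalfProductCuts.
End Compatibility.

Section CompatibilityIdentities.
Variable K : fieldType.
Local Notation A := (FQSym_plus K).
Local Notation G := (Frev K).
Local Notation prec := (@fq_prec K).
Local Notation succ := (@fq_succ K).
Local Notation mul := (dmul prec succ).
Local Notation Dprec := (@fq_Dprec K).
Local Notation Dsucc := (@fq_Dsucc K).
Local Notation Dt := (Dtilde Dprec Dsucc).

Lemma eq_big_seq_cond (R : Type) (idx : R) (op : R -> R -> R) (J : eqType)
    (r : seq J) (P : pred J) (F1 F2 : J -> R) :
  (forall i, i \in r -> P i -> F1 i = F2 i) ->
  \big[op/idx]_(i <- r | P i) F1 i = \big[op/idx]_(i <- r | P i) F2 i.
Proof.
by move=> eqF; rewrite big_seq_cond [RHS]big_seq_cond;
   apply: eq_bigr => i /andP[]; apply: eqF.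
Qed.

Lemma shuffles_r0s (s : seq nat) : s != [::] -> shuffles_r [::] s = [:: s].
Proof. by case: s. Qed.

Lemma shuffles_ls0 (s : seq nat) : s != [::] -> shuffles_l s [::] = [:: s].
Proof. by case: s => //= k s _; rewrite shuffless0. Qed.

Section Terms.
Variables (op : tensor A A -> A) (H : seq nat -> seq nat -> seq (seq nat)).
Variables (D : A -> tensor A A) (b : bool).
Hypotheses (opH : half_product op H)
  (Db : cut_coproduct D (fun w p => (max_letter w \in p) == b)).
Variables (x y : seq nat).
Hypothesis xy : words2 x y.

Local Notation S := (split_term K H).

Let opE s t : words2 s t -> op (G s ⊗ G t) = \sum_(w <- H s t) G w.
Proof. by case: (product_words opH) => _ h _; apply: h. Qed.

Let sum1 (w : seq nat) : \sum_(p <- [:: w]) G p = G w.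
Proof. exact: big_seq1. Qed.

Lemma sum_both_split :
  sw (Dt (G x)) (fun a1 a2 =>
    sw (D (G y)) (fun b1 b2 => mul a1 b1 ⊗ op (a2 ⊗ b2))) =
  \sum_(c <- inner_cuts x)
    \sum_(d <- inner_cuts y | (max_letter y \in d.1) == b) S c d.
Proof.
have [Ux Uy _ _ _] := xy; have [lop _ _] := product_words opH.
apply: (etrans (sw_cut_coproduct (cut_Dtilde K) (both_split_outer lop _) Ux)).
apply: eq_big_seq => c c_in.
apply: (etrans (sw_cut_coproduct Db (both_split_inner lop _ _) Uy)).
apply: eq_big_seq_cond => d d_in _.
have [cd1 cd2] := words2_inner xy c_in d_in.
exact: (congr2 (@tens K _ _) (mul_words K cd2) (opE cd1)).
Qed.

Lemma sum_left_split :
  sw (Dt (G x)) (fun a1 a2 => a1 ⊗ op (a2 ⊗ G y)) =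
  \sum_(c <- inner_cuts x) S c (y, [::]).
Proof.
have [Ux Uy _ _ _] := xy; have [lop _ _] := product_words opH.
apply: (etrans (sw_cut_coproduct (cut_Dtilde K) (left_split_inner lop _) Ux)).
apply: eq_big_seq => c c_in.
have [cy1 _] := words2_inner_l xy c_in.
by rewrite /split_term /= shuffless0 sum1; congr (_ ⊗ _); apply: opE.
Qed.

Lemma sum_right_split :
  sw (D (G y)) (fun b1 b2 => b1 ⊗ op (G x ⊗ b2)) =
  \sum_(d <- inner_cuts y | (max_letter y \in d.1) == b) S (x, [::]) d.
Proof.
have [Ux Uy _ _ _] := xy; have [lop _ _] := product_words opH.
apply: (etrans (sw_cut_coproduct Db (right_split_inner lop _) Uy)).
apply: eq_big_seq_cond => d d_in _.
have [xd1 _] := words2_inner_r xy d_in.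
by rewrite /split_term /= sum1; congr (_ ⊗ _); apply: opE.
Qed.

Lemma sum_right_split_mul : H = @shuffles_r nat ->
  sw (D (G y)) (fun b1 b2 => mul (G x) b1 ⊗ b2) =
  \sum_(d <- inner_cuts y | (max_letter y \in d.1) == b) S ([::], x) d.
Proof.
move=> HE; have [Ux Uy _ _ _] := xy.
apply: (etrans (sw_cut_coproduct Db (right_split_mul_inner _) Uy)).
apply: eq_big_seq_cond => d d_in _.
have [_ xd2] := words2_inner_r xy d_in; have [_ d10 _] := inner_cutsP d_in.
have -> : S ([::], x) d = (\sum_(q <- shuffles x d.2) G q) ⊗ G d.1.
  by rewrite /split_term HE (shuffles_r0s d10) sum1.
exact: (congr1 (fun z => z ⊗ G d.1) (mul_words K xd2)).
Qed.

Lemma sum_left_split_mul : H = @shuffles_l nat ->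
  sw (Dt (G x)) (fun a1 a2 => mul a1 (G y) ⊗ a2) =
  \sum_(c <- inner_cuts x) S c ([::], y).
Proof.
move=> HE; have [Ux Uy _ _ _] := xy.
apply: (etrans (sw_cut_coproduct (cut_Dtilde K) (left_split_mul_inner _) Ux)).
apply: eq_big_seq => c c_in.
have [_ cy2] := words2_inner_l xy c_in; have [_ c10 _] := inner_cutsP c_in.
have -> : S c ([::], y) = (\sum_(q <- shuffles c.2 y) G q) ⊗ G c.1.
  by rewrite /split_term HE (shuffles_ls0 c10) sum1.
exact: (congr1 (fun z => z ⊗ G c.1) (mul_words K cy2)).
Qed.

(** A half-shuffle that takes its head from an empty word does not exist. *)
Lemma split_term_empty c d : H c.1 d.1 = [::] -> S c d = 0.
Proof. by rewrite /split_term => ->; rewrite big_nil tens0r. Qed.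

(** The left tensor factor is indexed by the empty word. *)
Lemma split_term_whole : S (x, [::]) (y, [::]) = 0.
Proof. by rewrite /split_term /= sum1 [G [::]]Frev0 tens0l. Qed.

End Terms.

Let prec_l : half_product prec (@shuffles_l nat). Proof. by left. Qed.
Let succ_r : half_product succ (@shuffles_r nat). Proof. by right. Qed.

Lemma cut_Dsucc_eq :
  cut_coproduct Dsucc (fun w p => (max_letter w \in p) == true).
Proof.
have [lD DE] := cut_Dsucc K; split=> // w Uw; rewrite DE //.
by apply: eq_bigl => c; rewrite eqb_id.
Qed.

Lemma cut_Dprec_eq :
  cut_coproduct Dprec (fun w p => (max_letter w \in p) == false).
Proof.
have [lD DE] := cut_Dprec K; split=> // w Uw; rewrite DE //.
by apply: eq_bigl => c; rewrite eqbF_neg.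
Qed.

Let lp := @fq_prec_linear K.
Let ls := @fq_succ_linear K.
Let lDp := @fq_Dprec_linear K.
Let lDs := @fq_Dsucc_linear K.
Let addE (V : zmodType) (a b c d : V) : a = c -> b = d -> a + b = c + d.
Proof. by move=> -> ->. Qed.

Lemma FQSym_Dsucc_succ a b :
  Dsucc (succ (a ⊗ b)) =
      sw (Dt a) (fun a1 a2 =>
        sw (Dsucc b) (fun b1 b2 => mul a1 b1 ⊗ succ (a2 ⊗ b2)))
      + sw (Dt a) (fun a1 a2 => a1 ⊗ succ (a2 ⊗ b))
      + sw (Dsucc b) (fun b1 b2 => b1 ⊗ succ (a ⊗ b2))
      + sw (Dsucc b) (fun b1 b2 => mul a b1 ⊗ b2)
      + a ⊗ b.
Proof.
move: a b; apply: (bilin_eq (bilin_coproduct ls lDs) (bilin_add (bilin_add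
  (bilin_add (bilin_add (both_split_bilin ls lDs) (left_split_bilin ls))
    (right_split_bilin ls lDs)) (right_split_mul_bilin lDs))
  (bilin_tens (@lin_id K A) (@lin_id K A)))) => x y xy.
apply: (etrans (coproduct_half_product_inner succ_r cut_Dsucc_eq xy)).
have [_ _ _ y0 _] := xy; rewrite split_term_whole addr0.
apply: addE; last first.
  by rewrite /split_term (shuffles_r0s y0) [shuffles _ _]shuffless0 !big_seq1.
apply: addE; last exact: (esym (sum_right_split_mul cut_Dsucc_eq xy (erefl _))).
apply: addE; last exact: (esym (sum_right_split succ_r cut_Dsucc_eq xy)).
apply: addE; last exact: (esym (sum_left_split succ_r xy)).
exact: (esym (sum_both_split succ_r cut_Dsucc_eq xy)).
Qed.

Lemma FQSym_Dsucc_prec a b :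
  Dsucc (prec (a ⊗ b)) =
      sw (Dt a) (fun a1 a2 =>
        sw (Dsucc b) (fun b1 b2 => mul a1 b1 ⊗ prec (a2 ⊗ b2)))
      + sw (Dt a) (fun a1 a2 => a1 ⊗ prec (a2 ⊗ b))
      + sw (Dsucc b) (fun b1 b2 => b1 ⊗ prec (a ⊗ b2)).
Proof.
move: a b; apply: (bilin_eq (bilin_coproduct lp lDs) (bilin_add (bilin_add
  (both_split_bilin lp lDs) (left_split_bilin lp)) (right_split_bilin lp lDs))).
move=> x y xy.
apply: (etrans (coproduct_half_product_inner prec_l cut_Dsucc_eq xy)).
rewrite split_term_whole addr0 split_term_empty // addr0.
rewrite [X in _ + X]big1 ?addr0; last by move=> d _; apply: split_term_empty.
apply: addE; last exact: (esym (sum_right_split prec_l cut_Dsucc_eq xy)).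
apply: addE; last exact: (esym (sum_left_split prec_l xy)).
exact: (esym (sum_both_split prec_l cut_Dsucc_eq xy)).
Qed.

Lemma FQSym_Dprec_succ a b :
  Dprec (succ (a ⊗ b)) =
      sw (Dt a) (fun a1 a2 =>
        sw (Dprec b) (fun b1 b2 => mul a1 b1 ⊗ succ (a2 ⊗ b2)))
      + sw (Dprec b) (fun b1 b2 => mul a b1 ⊗ b2)
      + sw (Dprec b) (fun b1 b2 => b1 ⊗ succ (a ⊗ b2)).
Proof.
move: a b; apply: (bilin_eq (bilin_coproduct ls lDp) (bilin_add (bilin_add
  (both_split_bilin ls lDp) (right_split_mul_bilin lDp))
  (right_split_bilin ls lDp))) => x y xy.
apply: (etrans (coproduct_half_product_inner succ_r cut_Dprec_eq xy)).
rewrite split_term_empty // addr0 split_term_empty // addr0.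
rewrite [X in _ + X + _ + _]big1 ?addr0; last first.
  by move=> c _; apply: split_term_empty.
rewrite addrAC.
apply: addE; last exact: (esym (sum_right_split succ_r cut_Dprec_eq xy)).
apply: addE; last exact: (esym (sum_right_split_mul cut_Dprec_eq xy (erefl _))).
exact: (esym (sum_both_split succ_r cut_Dprec_eq xy)).
Qed.

Lemma FQSym_Dprec_prec a b :
  Dprec (prec (a ⊗ b)) =
      sw (Dt a) (fun a1 a2 =>
        sw (Dprec b) (fun b1 b2 => mul a1 b1 ⊗ prec (a2 ⊗ b2)))
      + sw (Dt a) (fun a1 a2 => mul a1 b ⊗ a2)
      + sw (Dprec b) (fun b1 b2 => b1 ⊗ prec (a ⊗ b2))
      + b ⊗ a.
Proof.
have bt : bilin (fun a b : A => b ⊗ a).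
  by split=> c; [apply: tens_linearr | apply: tens_linearl].
move: a b; apply: (bilin_eq (bilin_coproduct lp lDp) (bilin_add (bilin_add
  (bilin_add (both_split_bilin lp lDp) (left_split_mul_bilin K))
  (right_split_bilin lp lDp)) bt)).
move=> x y xy.
apply: (etrans (coproduct_half_product_inner prec_l cut_Dprec_eq xy)).
have [_ _ x0 _ _] := xy.
apply: addE; last first.
  by rewrite /split_term (shuffles_ls0 x0) !big_seq1.
rewrite split_term_empty // addr0.
rewrite [X in _ + X]big1 ?addr0; last by move=> d _; apply: split_term_empty.
apply: addE; last exact: (esym (sum_right_split prec_l cut_Dprec_eq xy)).
apply: addE; last exact: (esym (sum_left_split_mul xy (erefl _))).
exact: (esym (sum_both_split prec_l cut_Dprec_eq xy)).
Qed.

Lemma FQSym_bidendriform : bidendriform_bialgebra prec succ Dprec Dsucc.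
Proof.
split.
- exact: FQSym_dendriform_algebra.
- exact: FQSym_dendriform_coalgebra.
- exact: FQSym_Dsucc_succ.
- exact: FQSym_Dsucc_prec.
- exact: FQSym_Dprec_succ.
- exact: FQSym_Dprec_prec.
Qed.

End CompatibilityIdentities.

(** * Connectedness *)

Section SumsOf.

(** Sums suffice, without scalars, as coproducts of basis elements are sums of
    tensors of basis elements. *)
Inductive sum_of (V : zmodType) (S : V -> Prop) : V -> Prop :=
| SumOf0 : sum_of S 0
| SumOfD x y : S x -> sum_of S y -> sum_of S (x + y).

Lemma sum_of_big (V : zmodType) (S : V -> Prop) (J : eqType) (r : seq J)
    (P : pred J) (E : J -> V) :
  (forall i, i \in r -> P i -> S (E i)) -> sum_of S (\sum_(i <- r | P i) E i).
Proof.
elim: r => [|i r IHr] SE; first by rewrite big_nil; apply: SumOf0.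
have Sr : sum_of S (\sum_(j <- r | P j) E j).
  by apply: IHr => j j_in; apply: SE; rewrite inE j_in orbT.
rewrite big_cons; case: (boolP (P i)) => // Pi.
by apply: SumOfD => //; apply: SE; rewrite ?mem_head.
Qed.

Lemma sum_of_add (V : zmodType) (S : V -> Prop) x y :
  sum_of S x -> sum_of S y -> sum_of S (x + y).
Proof.
elim=> [|s t Ss _ IHt] Sy; first by rewrite add0r.
by rewrite -addrA; apply: SumOfD => //; apply: IHt.
Qed.

Variable K : fieldType.

Lemma sum_of_lin (V W : lmodType K) (S : V -> Prop) (S' : W -> Prop)
    (f : V -> W) : linear f ->
  (forall x, S x -> sum_of S' (f x)) -> forall x, sum_of S x -> sum_of S' (f x).
Proof.
move=> lf Sf x; elim=> [|s t Ss _ IHt]; first by rewrite lin0 //; apply: SumOf0.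
by rewrite linD //; apply: sum_of_add => //; apply: Sf.
Qed.

Lemma sum_of_eq0 (V : zmodType) (S : V -> Prop) x :
  (forall y, S y -> y = 0) -> sum_of S x -> x = 0.
Proof. by move=> S0; elim=> // s t /S0-> _ ->; rewrite addr0. Qed.

End SumsOf.

Section Connected.
Variable K : fieldType.
Local Notation A := (FQSym_plus K).
Local Notation G := (Frev K).
Local Notation Dprec := (@fq_Dprec K).
Local Notation Dsucc := (@fq_Dsucc K).

Lemma tpow_at_linear (D : A -> tensor A A) n i : linear D ->
  linear (@tpow_at K A D n i).
Proof.
move=> lD; elim: n i => [|n IHn] [|i] //=; last first.
  exact: (tmap_linear (@lin_id K A) (IHn i)).
exact: (lin_comp (@tassoc_linear K _ _ _) (tmap_linear lD (@lin_id K _))).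
Qed.

(** Tensors of basis elements of total degree [d], represented by words: the
    grading of the tensor powers. *)
Fixpoint pure_tensor n (d : nat) : tpow A n -> Prop :=
  if n is n'.+1 return tpow A n -> Prop then
    fun t => exists w e s,
      [/\ uniq w, t = G w ⊗ s, (size w + e)%N = d & pure_tensor e s]
  else fun t => exists w, [/\ uniq w, t = G w & size w = d].

(** A total degree at most [n] cannot be shared by [n.+1] nonempty words. *)
Lemma pure_tensor_eq0 n d (t : tpow A n) :
  (d <= n)%N -> pure_tensor d t -> t = 0.
Proof.
elim: n d t => [|n IHn] d t le_d /=.
  by case=> w [_ -> sw]; move: le_d; rewrite -sw leqn0 size_eq0 => /eqP->.
case=> w [e [s [_ -> sw]]]; case: w sw => [|k w] sw s_pure.
  by rewrite [G _]Frev0 tens0l.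
rewrite (IHn e s) ?tens0r //; rewrite -ltnS.
by apply: leq_trans le_d; rewrite -sw /= addSn ltnS leq_addl.
Qed.

(** Cutting a word preserves the total length. *)
Lemma tpow_at_pure D P n i d (t : tpow A n) : cut_coproduct D P ->
  pure_tensor d t -> sum_of (@pure_tensor n.+1 d) (tpow_at D i t).
Proof.
move=> DP; have [lD DE] := DP; elim: n i d t => [|n IHn] i d t.
  move=> [w [Uw -> sw]].
  change (sum_of (@pure_tensor 1 d) (D (G w))).
  rewrite DE //; apply: sum_of_big => c c_in _.
  have [U1 U2] := cuts_uniq Uw c_in.
  exists c.2, (size c.1), (G c.1); split=> //; last by exists c.1.
  by rewrite -sw (cuts_cat c_in) size_cat addnC.
move=> [w [e [s [Uw -> sw s_pure]]]]; case: i => [|i].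
  change (sum_of (@pure_tensor n.+2 d) (tassoc (tmap D id (G w ⊗ s)))).
  rewrite (tmap_tens _ _ lD (@lin_id K _)) DE //.
  rewrite (lin_sum (@tens_linearl K _ _ s)) (lin_sum (@tassoc_linear K _ _ _)).
  apply: sum_of_big => c c_in _; rewrite tassoc_tens.
  have [U1 U2] := cuts_uniq Uw c_in.
  exists c.2, (size c.1 + e)%N, (G c.1 ⊗ s); split=> //.
    by rewrite addnA -sw (cuts_cat c_in) size_cat [(size c.2 + _)%N]addnC.
  by exists c.1, e, s.
change (sum_of (@pure_tensor n.+2 d)
  (tmap id (@tpow_at K A D n i) (G w ⊗ s))).
rewrite (tmap_tens _ _ (@lin_id K _) (@tpow_at_linear D n i lD)).
apply: (sum_of_lin (S := @pure_tensor n.+1 e) (@tens_linearr K _ _ (G w))).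
  move=> r r_pure; rewrite -[_ ⊗ _]addr0; apply: SumOfD; last exact: SumOf0.
  by exists w, e, r.
exact: IHn.
Qed.

Lemma iter_coproduct_pure n (P : A -> tpow A n) :
  iter_coproduct Dprec Dsucc P ->
  linear P /\
  forall w, uniq w -> sum_of (@pure_tensor n (size w)) (P (G w)).
Proof.
elim=> {n P} [|n i P _ [lP PG]|n i P _ [lP PG]].
- split=> // w Uw; rewrite -[G w]addr0; apply: SumOfD; last exact: SumOf0.
  by exists w.
- split; first exact: (lin_comp (@tpow_at_linear _ n i (@fq_Dprec_linear K)) lP).
  move=> w Uw; have lD := @tpow_at_linear _ n i (@fq_Dprec_linear K).
  apply: (sum_of_lin lD _ (PG w Uw)) => t.
  exact: (tpow_at_pure i (cut_Dprec K)).
- split; first exact: (lin_comp (@tpow_at_linear _ n i (@fq_Dsucc_linear K)) lP).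
  move=> w Uw; have lD := @tpow_at_linear _ n i (@fq_Dsucc_linear K).
  apply: (sum_of_lin lD _ (PG w Uw)) => t.
  exact: (tpow_at_pure i (cut_Dsucc K)).
Qed.

(** An element involves finitely many permutations, so a bound on their sizes
    is a number of iterations that kills it. *)
Lemma FQSym_connected : connected_coalgebra Dprec Dsucc.
Proof.
move=> a; have [N leN] : exists N, forall t, t \in msupp a -> (tag t < N)%N.
  exists (\max_(t <- msupp a) (tag t).+1) => t t_in.
  exact: (leq_bigmax_seq (F := fun t => (tag t).+1)).
exists N => P /iter_coproduct_pure[lP PG].
rewrite [in LHS](FQSym_plusE a) (lin_sum lP).
apply: big1_seq => t /andP[_ t_in].
suff e : P (F K (tagged t)) = 0.
  by have := lP a@_t (F K (tagged t)) 0; rewrite (lin0 lP) !addr0 e scaler0.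
rewrite -(Frev_word K (tagged t)).
apply: sum_of_eq0 (PG _ _) => [s|]; last by rewrite rev_uniq word_uniq.
by apply: pure_tensor_eq0; rewrite size_rev size_word leN.
Qed.

End Connected.

Theorem theorem38 (K : fieldType) :
  connected_bidendriform_bialgebra
    (@fq_prec K) (@fq_succ K) (@fq_Dprec K) (@fq_Dsucc K).
Proof.
split; [exact: FQSym_bidendriform | exact: FQSym_connected].
Qed.
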